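(* Let $P\subset\mathbb{R}^d$ be a $d$-dimensional reflexive simplicial polytope, with $f$-vector entry $f_{d-1}$ (the number of facets of $P$), $h$-vector $(h_0,\ldots,h_d)$ and $\delta$-vector $(\delta_0,\ldots,\delta_d)$. The following are equivalent: (i) $P$ is smooth Fano; (ii) $h_k=\delta_k$ for all $0\le k\le d$; (iii) $f_{d-1}=d!\,\mathrm{vol}(P)$; (iv) $f_{d-1}=(d-1)!\,\mathrm{vol}(\partial P)$.
   Context: A convex lattice polytope in $\mathbb{R}^d$ is the convex hull of finitely many points of $\mathbb{Z}^d$. A $d$-dimensional convex lattice polytope $P\subset\mathbb{R}^d$ with the origin in its strict interior is called reflexive if the dual polytope $P^\vee=\{u\in\mathbb{R}^d : \langle u,v\rangle\le 1\text{ for all }v\in P\}$ is also a lattice polytope. A $d$-dimensional convex lattice polytope with the origin in its strict interior is called smooth Fano if the vertices of each facet form a $\mathbb{Z}$-basis of $\mathbb{Z}^d$. A polytope is simplicial if all its proper faces are simplices. $\mathrm{vol}(P)$ is the ordinary Euclidean ($d$-dimensional) volume. The boundary volume $\mathrm{vol}(\partial P)$ is the sum over all facets $F$ of $P$ of the $(d-1)$-dimensional volume of $F$, normalized with respect to the lattice $\mathrm{aff}(F)\cap\mathbb{Z}^d$ (so that a fundamental parallelepiped of this lattice has volume $1$). For $m\ge 0$ let $L_P(m)=|mP\cap\mathbb{Z}^d|$. The $\delta$-vector $(\delta_0,\ldots,\delta_d)$ of $P$ is defined by $\sum_{m\ge0}L_P(m)t^m=\dfrac{\delta_0+\delta_1t+\cdots+\delta_dt^d}{(1-t)^{d+1}}$.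 For a simplicial $d$-polytope $P$, $f_i$ is the number of $i$-dimensional faces ($f_{-1}=1$), and the $h$-vector $(h_0,\ldots,h_d)$ is that of the boundary complex, defined by $\sum_{k=0}^d h_kx^k=\sum_{i=0}^d f_{i-1}x^i(1-x)^{d-i}$. *)

(* Defs.v *)
From HB Require Import structures.
From mathcomp Require Import all_boot all_order all_algebra finmap.
From mathcomp Require Import all_classical all_reals all_analysis.

Set Implicit Arguments.
Unset Strict Implicit.
Unset Printing Implicit Defensive.

Import Order.TTheory GRing.Theory Num.Theory.
Import numFieldNormedType.Exports.

Local Open Scope classical_set_scope.
Local Open Scope ring_scope.

(* Points of R^d are row vectors; a finite family of n points is the matrix
   V : 'M[R]_(n, d) of its rows, so c *m V is the combination with
   coefficients c. *)

Section Polytopes.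
Variables (R : realType) (d : nat).
Implicit Types (A F P : set 'rV[R]_d).

Definition dotp (u v : 'rV[R]_d) : R := \sum_i u 0 i * v 0 i.

Definition int_lattice : set 'rV[R]_d :=
  range (map_mx intr : 'rV[int]_d -> 'rV[R]_d).

Definition conv_hull n (V : 'M[R]_(n, d)) : set 'rV[R]_d :=
  [set x | exists c : 'rV[R]_n,
    [/\ forall i, 0 <= c 0 i, \sum_i c 0 i = 1 & x = c *m V]].

Definition aff_hull A : set 'rV[R]_d :=
  [set x | exists n (V : 'M[R]_(n, d)) (c : 'rV[R]_n),
    [/\ forall i, A (row i V), \sum_i c 0 i = 1 & x = c *m V]].

Definition aff_indep n (V : 'M[R]_(n, d)) :=
  forall c : 'rV[R]_n, \sum_i c 0 i = 0 -> c *m V = 0 -> c = 0.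

(* [has_aff_indep A n]: A contains n affinely independent points. *)
Definition has_aff_indep A n :=
  exists V : 'M[R]_(n, d), (forall i, A (row i V)) /\ aff_indep V.

(* The empty set, of dimension -1, satisfies [has_dim] for no k. *)
Definition has_dim A k := has_aff_indep A k.+1 /\ ~ has_aff_indep A k.+2.

Definition lattice_polytope P :=
  exists n (V : 'M[R]_(n, d)),
    (forall i, int_lattice (row i V)) /\ P = conv_hull V.

Definition dual P : set 'rV[R]_d :=
  [set u | forall v, P v -> dotp u v <= 1].

Definition reflexive_polytope P :=
  [/\ lattice_polytope P, has_dim P d, P° 0 & lattice_polytope (dual P)].

(* Since a = 0 is allowed, P itself and (when P is nonempty) set0 are faces. *)
Definition face P F :=
  exists (a : 'rV[R]_d) (b : R),
    (forall x, P x -> dotp a x <= b) /\ F = [set x | P x /\ dotp a x = b].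

Definition facet P F := face P F /\ has_dim F d.-1.

Definition vertex P v := face P [set v].

Definition simplex F :=
  exists n (V : 'M[R]_(n, d)), aff_indep V /\ F = conv_hull V.

(* Here P is assumed to be a polytope. *)
Definition simplicial P := forall F, face P F -> F <> P -> simplex F.

(* The rows of B form a basis over the integers of the subgroup L of R^d. *)
Definition Z_basis (L : set 'rV[R]_d) n (B : 'M[R]_(n, d)) :=
  (forall i, L (row i B)) /\
  (forall z, L z -> exists! c : 'rV[int]_n, z = map_mx intr c *m B).

Definition smooth_Fano P :=
  [/\ lattice_polytope P, has_dim P d, P° 0 &
    forall F, facet P F ->
      exists n (B : 'M[R]_(n, d)),
        vertex F = range (fun i => row i B) /\ Z_basis int_lattice B].

Definition f_vector P i : nat := #|` fset_set [set F | face P F /\ has_dim F i]|.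

(* The first summand is the term f_(-1) = 1. *)
Definition h_poly P : {poly int} :=
  (1 - 'X) ^+ d +
  \sum_(i < d) (f_vector P i)%:R *: ('X^(i.+1) * (1 - 'X) ^+ (d - i.+1)).

Definition h_vector P k : int := (h_poly P)`_k.

Definition ehrhart P (m : nat) : nat :=
  #|` fset_set ([set m%:R *: x | x in P] `&` int_lattice)|.

(* p = (1 - t) ^ (d + 1) * (sum over m of L_P(m) t^m) as formal power series,
   coefficient by coefficient. *)
Definition is_delta_poly P (p : {poly int}) :=
  (size p <= d.+1)%N /\
  forall m, \sum_(j < m.+1) ((1 - 'X) ^+ d.+1 : {poly int})`_j *
              (ehrhart P (m - j))%:R = p`_m.

(* The default 0 is a junk value: it is never the delta-polynomial of a
   nonempty P, which has constant coefficient L_P(0) = 1. *)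
Definition delta_poly P : {poly int} := xget 0 [set p | is_delta_poly P p].

Definition delta_vector P k : int := (delta_poly P)`_k.

End Polytopes.

(* n-dimensional Lebesgue measure as an iterated product measure: as in
   [product_measure1], the measure of A is the integral of the measures of its
   sections.  R^0 is a point of volume 1. *)
Fixpoint vol (R : realType) (n : nat) : set 'rV[R]_n -> \bar R :=
  match n with
  | 0 => fun A : set 'rV[R]_0 => (\1_A 0)%:E
  | n'.+1 => fun A : set 'rV[R]_n'.+1 =>
      (\int[@lebesgue_measure R]_x
        vol [set y : 'rV[R]_n' | A (row_mx (x%:M : 'rV[R]_1) y)])%E
  end.

Section BoundaryVolume.
Variables (R : realType) (d : nat).
Implicit Types (F P : set 'rV[R]_d).

(* x |-> p + x *m B is a parametrization of aff(F) by R^n that maps Z^n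
   bijectively onto the lattice points of aff(F). *)
Definition lattice_chart F n (p : 'rV[R]_d) (B : 'M[R]_(n, d)) :=
  let L := aff_hull F `&` @int_lattice R d in
  L p /\ Z_basis [set y | L (p + y)] B.

(* The n-dimensional volume of F normalized by the lattice aff(F) /\ Z^d; two
   lattice charts differ by an affine unimodular map, so that the value does
   not depend on the chart. *)
Definition normalized_vol n F : \bar R :=
  xget 0%E [set v | exists p (B : 'M[R]_(n, d)),
    lattice_chart F p B /\ v = vol [set x : 'rV[R]_n | F (p + x *m B)]].

Definition boundary_vol P : \bar R :=
  (\sum_(F \in [set F | facet P F]) normalized_vol d.-1 F)%E.

End BoundaryVolume.

(* Main.v *)
Require Import Defs.
From HB Require Import structures.
From mathcomp Require Import all_boot all_order all_algebra.
From mathcomp Require Import finmap intdiv ring lra zify.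
From mathcomp Require Import all_classical all_reals all_analysis.
From mathcomp Require Import measurable_realfun.

(** Let T_1, ..., T_q be the facets of P.  Each is a simplex with d vertices,
which are lattice points; let V_j be the integer matrix of the vertices of T_j.
Since P is reflexive, T_j lies on a hyperplane <w_j, x> = 1 with w_j integral,
so V_j is invertible.  The rows of V_j form a basis of Z^d exactly when
|det V_j| = 1, hence (i) says that all the positive integers |det V_j| are 1,
and each of the other statements is compared with this one.

Volumes.  P is the union of the simplices conv(0, T_j), of volume
|det V_j| / d!, which overlap in null sets ([vol_polytope]).  A chart of the
lattice points of the hyperplane of T_j completes to a unimodular matrix,
because that hyperplane has lattice height 1, so the normalized volume of T_j
is |det V_j| / (d - 1)! ([normalized_vol_simplex]).  Thus d! vol(P) and
(d - 1)! vol(bd P) are both the sum of the q numbers |det V_j| >= 1, which is q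
if and only if all of them are 1.  The volume is an iterated integral, and the
change of variables that it needs ([vol_linear]) is proved by induction on the
dimension: a block elimination writes an invertible matrix as a product of
shears and of a block diagonal matrix, and shears only use the translation
invariance of the measure of the sections in one of the two orders of
integration.

Lattice points.  Every point of R^d has a unique expression as a nonnegative
combination of vertices of a common facet ([cone_cover], [cone_unique]), and
its coefficients add up to at most m exactly on the dilate m P.  The nonnegative
integer combinations of this kind with sum at most m are therefore distinct
lattice points of m P.  Their number is sum_k f_(k-1) binomial(m, k), whose
generating series is h(t) / (1 - t)^(d+1) whatever P is ([combos_delta]).
Hence h = delta if and only if every lattice point of every dilate is such an
integer combination ([h_delta_combos]), that is, if and only if the vertices of
every facet span Z^d ([unit_combosP]).

The facets are reached through one choice: P and its dual are written as convex
hulls of families from which no point can be dropped.  The generators of the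
dual are then the facet normals, since they are extreme points
([tight_spanning]).  Given x, a facet whose cone contains x is found by
maximizing <w_j, x>: a negative coefficient of x on the vertices of that facet
would allow a pivot to a larger value. *)

Set Implicit Arguments.
Unset Strict Implicit.
Unset Printing Implicit Defensive.

Import Order.TTheory GRing.Theory Num.Theory.
Import numFieldNormedType.Exports.

Local Open Scope classical_set_scope.
Local Open Scope ring_scope.

(** * Volume as a measure on row vectors *)

Definition row_display : measure_display -> measure_display.
Proof. exact. Qed.

(** Row vectors carry the sigma-algebra generated by the coordinates, for which
measurability of a map is checked coordinatewise. *)
Section RowMeasurable.
Variables (R : realType) (n : nat).

Let coord (i : 'I_n) (x : 'rV[R]_n) : measurableTypeR R := x 0 i.

Let row_set0 : g_sigma_preimage coord set0.
Proof. exact: sigma_algebra0. Qed.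

Let row_setC A : g_sigma_preimage coord A -> g_sigma_preimage coord (~` A).
Proof. exact: sigma_algebraC. Qed.

Let row_bigcup (F : (set 'rV[R]_n)^nat) : (forall i, g_sigma_preimage coord (F i)) ->
  g_sigma_preimage coord (\bigcup_i (F i)).
Proof. exact: sigma_algebra_bigcup. Qed.

HB.instance Definition _ := @isMeasurable.Build (row_display default_measure_display)
  'rV[R]_n (g_sigma_preimage coord) row_set0 row_setC row_bigcup.

Lemma measurable_coord (i : 'I_n) :
  measurable_fun [set: 'rV[R]_n] (fun x => x 0 i : measurableTypeR R).
Proof.
move=> _ Y mY; rewrite setTI; apply: sub_sigma_algebra => /=.
rewrite -bigcup_seq/=; exists i => /=; first by rewrite mem_index_enum.
by exists Y => //; rewrite setTI.
Qed.

Lemma measurable_fun_rowP d (T : measurableType d) (f : T -> 'rV[R]_n) :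
  measurable_fun [set: T] f <->
  forall i, measurable_fun [set: T] (fun t => f t 0 i : measurableTypeR R).
Proof.
split=> [mf i|mf].
  exact: (measurableT_comp (measurable_coord i) mf).
move=> _ B; rewrite setTI => mB.
have : g_sigma_preimage (fun i => coord i \o f) (f @^-1` B).
  rewrite (g_sigma_preimage_comp coord f).
  by exists B => //; rewrite setTI.
apply: smallest_sub; first exact: sigma_algebra_measurable.
rewrite -bigcup_seq; apply: bigcup_sub => i _.
by move=> A [C mC <-]; exact: mf.
Qed.

End RowMeasurable.

(** The isomorphism R x R^n -> R^(n+1) along which [vol] iterates: the scalar is
the outer variable of integration. *)
Definition cons_row (R : realType) n (z : measurableTypeR R * 'rV[R]_n) : 'rV[R]_n.+1 :=
  row_mx ((z.1 : R)%:M : 'rV[R]_1) z.2.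

Definition behead_row (R : realType) n (x : 'rV[R]_n.+1) : 'rV[R]_n :=
  @rsubmx _ 1 1 n x.

Section ConsRow.
Variables (R : realType) (n : nat).

Lemma cons_row0 (z : measurableTypeR R * 'rV[R]_n) : cons_row z 0 0 = z.1.
Proof.
rewrite /cons_row mxE; case: splitP => [j _|k] //=.
by rewrite ord1 mxE eqxx mulr1n.
Qed.

Lemma cons_rowS (z : measurableTypeR R * 'rV[R]_n) i :
  cons_row z 0 (lift 0 i) = z.2 0 i.
Proof.
rewrite /cons_row mxE; case: splitP => [j|k] /=.
  by rewrite ord1.
by rewrite /bump/= !add1n => -[ik]; congr (z.2 0 _); apply/val_inj.
Qed.

Lemma measurable_cons_row : measurable_fun setT (@cons_row R n).
Proof.
apply/measurable_fun_rowP => i.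
case: (unliftP 0 i) => [j ->|->].
  under eq_fun do rewrite cons_rowS.
  exact: (measurableT_comp (measurable_coord j) measurable_snd).
by under eq_fun do rewrite cons_row0; exact: measurable_fst.
Qed.

Lemma cons_rowK (x : 'rV[R]_n.+1) : cons_row (x 0 0, behead_row x) = x.
Proof.
apply/rowP => i; case: (unliftP 0 i) => [j ->|->]; last by rewrite cons_row0.
by rewrite cons_rowS /= mxE; congr (x _ _); apply/val_inj.
Qed.

Lemma cons_row_behead (z : measurableTypeR R * 'rV[R]_n) :
  behead_row (cons_row z) = z.2.
Proof. by rewrite /behead_row /cons_row row_mxKr. Qed.

Lemma measurable_behead_row : measurable_fun setT (@behead_row R n).
Proof.
apply/measurable_fun_rowP => i; under eq_fun do rewrite mxE.
exact: measurable_coord.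
Qed.

End ConsRow.

Section VolMeasure.
Variable R : realType.
Local Open Scope ereal_scope.
Notation lam := (@lebesgue_measure R).

(** The product of the Lebesgue measure and of the measure in dimension n,
transported by [cons_row], has the iterated integral of [vol] as its value on
measurable sets. *)
Lemma vol_measure n : exists mu : {sigma_finite_measure set 'rV[R]_n -> \bar R},
  forall A, measurable A -> vol A = mu A.
Proof.
elim: n => [|n [mu IH]].
  exists (dirac (0%R : 'rV[R]_0)) => A mA /=.
  by rewrite /dirac.
pose l : {sigma_finite_measure set (measurableTypeR R) -> \bar R} := lam.
pose p : {measure set (measurableTypeR R * 'rV[R]_n)%type -> \bar R} := (l \x mu)%E.
pose m (A : set 'rV[R]_n.+1) := p (@cons_row R n @^-1` A).
have m0 : m set0 = 0.
  by rewrite /m preimage_set0 measure0.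
have mE (A : set 'rV[R]_n.+1) : measurable A -> measurable (@cons_row R n @^-1` A).
  by move=> mA; rewrite -[X in measurable X]setTI; exact: measurable_cons_row.
have m_ge0 A : 0 <= m A by rewrite /m; exact: measure_ge0.
have m_sa : semi_sigma_additive m.
  move=> F mF tF mUF; rewrite /m preimage_bigcup.
  apply: measure_semi_sigma_additive.
  - by move=> i; exact: mE.
  - apply/trivIsetP => /= i j _ _ ij; rewrite -preimage_setI.
    by move/trivIsetP : tF => /(_ _ _ _ _ ij) ->//; rewrite preimage_set0.
  - by rewrite -preimage_bigcup; exact: mE.
have m_sf : sigma_finite setT m.
  have /sigma_finiteP[/= F [FT ndF Foo]] := sigma_finiteT l.
  have /sigma_finiteP[/= G [GT ndG Goo]] := sigma_finiteT mu.
  pose uncons (x : 'rV[R]_n.+1) := (x 0%R 0%R : measurableTypeR R, behead_row x).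
  have muncons : measurable_fun setT uncons.
    apply/measurable_fun_pairP; split; first exact: measurable_coord.
    exact: measurable_behead_row.
  exists (fun k => uncons @^-1` (F k `*` G k)).
    rewrite predeqE => x; split => // _.
    have : (\bigcup_i F i) (uncons x).1 by rewrite -FT.
    have : (\bigcup_i G i) (uncons x).2 by rewrite -GT.
    move=> [k _ Gk] [i _ Fi]; exists (maxn i k) => //; split => /=.
    - by have /subsetPset/(_ _ Fi) := ndF _ _ (leq_maxl i k).
    - by have /subsetPset/(_ _ Gk) := ndG _ _ (leq_maxr i k).
  move=> k; have [mFk Fk] := Foo k; have [mGk Gk] := Goo k; split.
    by rewrite -[X in measurable X]setTI; apply: muncons => //; exact: measurableX.
  rewrite /m -comp_preimage.
  rewrite [X in X @^-1` _](_ : _ = idfun) ?preimage_id; last first.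
    by apply/funext => -[x y]/=; rewrite /uncons cons_row_behead cons_row0.
  by rewrite /p/= product_measure1E// lte_mul_pinfty// ge0_fin_numE.
pose mM := isMeasure.Build _ _ _ m m0 m_ge0 m_sa.
pose m1 : {measure set 'rV[R]_n.+1 -> \bar R} := HB.pack m mM.
pose mS := Measure_isSigmaFinite.Build _ _ _ m1 m_sf.
pose mm : {sigma_finite_measure set 'rV[R]_n.+1 -> \bar R} :=
  HB.pack m mM mS.
exists mm => A mA /=.
rewrite /mm/= /m /p /product_measure1.
apply: eq_integral => x _ /=; rewrite IH.
  by congr (mu _); rewrite /xsection/=; apply/seteqP; split=> y/=; rewrite inE.
have /= := @measurable_xsection _ _ _ _ _ x (mE _ mA).
rewrite /xsection/=; set B := (X in _ -> measurable X).
by rewrite [X in measurable X -> _](_ : _ = B)//; apply/seteqP; split=> y/=; rewrite inE.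
Qed.

End VolMeasure.

Section LebesgueAffine.
Variable R : realType.
Notation lam := (@lebesgue_measure R).

(** By uniqueness of the Lebesgue measure it is enough to compare intervals; the
same holds for scaling below. *)
Lemma lebesgue_measure_shift (a : R) (A : set R) : measurable A ->
  lam [set x | A (x + a)] = lam A.
Proof.
move=> mA.
have mf : measurable_fun [set: R] (fun x => x + a : measurableTypeR R).
  exact: measurable_funD.
suff /(_ A mA) -> : forall A, measurable A ->
  lam A = pushforward lam (fun x => x + a : measurableTypeR R) A by [].
apply: lebesgue_measure_unique => //= _ [[u v]] _ <-.
rewrite /pushforward /=.
rewrite (_ : _ @^-1` _ = `]u - a, v - a]%classic); last first.
  by apply/seteqP; split => x /=; rewrite !in_itv /= ltrBlDr lerBrDr.
rewrite !lebesgue_measure_itv /= !lte_fin ltrD2r.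
case: ifP => // _; rewrite -!EFinD; congr (_%:E); lra.
Qed.

Lemma lebesgue_measure_scale (a : R) (A : set R) : a != 0 -> measurable A ->
  lam [set x | A (a * x)] = (`|a|^-1%:E * lam A)%E.
Proof.
move=> a0 mA.
have na0 : 0 < `|a| by rewrite normr_gt0.
have mf : measurable_fun [set: R] (fun x => a * x : measurableTypeR R).
  exact: measurable_funM.
pose c : {nonneg R} := NngNum (normr_ge0 a).
suff /(_ mf A mA) -> : forall A, measurable A ->
    lam A = @mscale _ _ _ c (@pushforward _ _ _ _ _ lam (fun x => a * x : measurableTypeR R)) A.
  rewrite /mscale /= /pushforward muleA -EFinM mulVf ?mul1e//.
  by rewrite gt_eqF.
move=> m; apply: lebesgue_measure_unique => //= _ [[u v]] _ <-.
rewrite /mscale /= /pushforward.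
case: (ltgtP a 0) a0 => // [a0|a0] _.
    rewrite (_ : _ @^-1` _ = `[a^-1 * v, a^-1 * u[%classic); last first.
    apply/seteqP; split => x /=; rewrite !in_itv /=.
      by rewrite ler_ndivrMl // ltr_ndivlMl // => /andP[-> ->].
    by rewrite ler_ndivrMl // ltr_ndivlMl // => /andP[-> ->].
  rewrite !lebesgue_measure_itv /= !lte_fin ltr_nM2l ?invr_lt0// .
  case: ifP => _; last by rewrite mule0.
  rewrite -!EFinD -EFinM; congr (_%:E); rewrite ltr0_norm//.
  by rewrite -mulrBr mulrA mulNr divff ?lt_eqF// mulN1r opprB.
rewrite (_ : _ @^-1` _ = `]a^-1 * u, a^-1 * v]%classic); last first.
  by apply/seteqP; split => x /=; rewrite !in_itv /= ltr_pdivrMl // ler_pdivlMl.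
rewrite !lebesgue_measure_itv /= !lte_fin ltr_pM2l ?invr_gt0//.
case: ifP => _; last by rewrite mule0.
rewrite -!EFinD -EFinM; congr (_%:E); rewrite gtr0_norm//.
by rewrite -mulrBr mulrA divff ?gt_eqF// mul1r.
Qed.
End LebesgueAffine.

Section VolumeTransform.
Variable R : realType.
Notation lam := (@lebesgue_measure R).

(** [volm] is [vol] with its structure of sigma-finite measure; the two agree on
measurable sets only. *)
Definition volm n : {sigma_finite_measure set 'rV[R]_n -> \bar R} :=
  sval (cid (@vol_measure R n)).

Lemma volE n (A : set 'rV[R]_n) : measurable A -> vol A = volm n A.
Proof. exact: (svalP (cid (@vol_measure R n))). Qed.

Lemma measurable_cons_row_preimage n (A : set 'rV[R]_n.+1) : measurable A ->
  measurable (@cons_row R n @^-1` A).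
Proof.
by move=> mA; rewrite -[X in measurable X]setTI; exact: measurable_cons_row.
Qed.

Lemma measurable_section n (A : set 'rV[R]_n.+1) (x : R) : measurable A ->
  measurable [set y | A (cons_row (x, y))].
Proof.
move=> /measurable_cons_row_preimage/(measurable_xsection x).
rewrite /xsection/=; set B := (X in measurable X -> _); set C := (X in _ -> measurable X).
by suff -> : B = C by []; apply/seteqP; split=> y; rewrite /B/C/= inE.
Qed.

Lemma measurable_rsection n (A : set 'rV[R]_n.+1) (y : 'rV[R]_n) : measurable A ->
  measurable [set x : R | A (cons_row (x, y))].
Proof.
move=> /measurable_cons_row_preimage/(measurable_ysection y).
set B := (X in measurable X -> _); set C := (X in _ -> measurable X).
by suff -> : B = C by []; apply/seteqP; split=> x; rewrite /B/C/ysection/= inE.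
Qed.

(** Tonelli: the volume can also be computed by integrating the head coordinate
first. *)
Lemma vol_rsections n (A : set 'rV[R]_n.+1) : measurable A ->
  vol A = (\int[volm n]_y lam [set x | A (cons_row (x, y))])%E.
Proof.
move=> mA; have mA' := measurable_cons_row_preimage mA.
pose l : {sigma_finite_measure set (measurableTypeR R) -> \bar R} := lam.
pose p2 : {measure set (measurableTypeR R * 'rV[R]_n)%type -> \bar R} := (l \x^ volm n)%E.
have := @product_measure_unique _ _ _ _ _ l (volm n) p2 _ _ mA'.
move=> /(_ (fun B C mB mC => product_measure2E _ _ mB mC)) /= E.
transitivity ((l \x volm n)%E (@cons_row R n @^-1` A)).
  rewrite /product_measure1 /=; apply: eq_integral => x _ /=.
  rewrite volE; last exact: measurable_section.
  by congr (volm _ _); rewrite /xsection/=; apply/seteqP; split=> y/=; rewrite inE.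
rewrite E /product_measure2; apply: eq_integral => y _ /=.
by congr (lam _); rewrite /ysection/=; apply/seteqP; split=> x/=; rewrite inE.
Qed.

Lemma measurable_preimage n m (f : 'rV[R]_n -> 'rV[R]_m) (A : set 'rV[R]_m) :
  (forall i, measurable_fun [set: 'rV[R]_n] (fun x => f x 0 i : measurableTypeR R)) ->
  measurable A -> measurable [set x | A (f x)].
Proof.
by move=> /measurable_fun_rowP mf mA; rewrite -[X in measurable X]setTI; exact: mf.
Qed.

Lemma measurable_affine n m (M : 'M[R]_(n, m)) (b : 'rV[R]_m) (A : set 'rV[R]_m) :
  measurable A -> measurable [set x | A (x *m M + b)].
Proof.
apply: measurable_preimage => i.
under eq_fun do rewrite !mxE.
apply: measurable_funD => //.
apply: measurable_sum => j.
by apply: measurable_funM => //; exact: measurable_coord.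
Qed.

Lemma measurable_linear n m (M : 'M[R]_(n, m)) (A : set 'rV[R]_m) :
  measurable A -> measurable [set x | A (x *m M)].
Proof.
by move=> /(measurable_affine M 0); under eq_fun do rewrite addr0.
Qed.

End VolumeTransform.

(** * Affine change of variables *)

Section VolumeLinear.
Variable R : realType.
Notation lam := (@lebesgue_measure R).

Lemma behead_rowE n (z : 'rV[R]_n.+1) i : behead_row z 0 i = z 0 (lift 0 i).
Proof. by rewrite mxE; congr (z _ _); apply/val_inj. Qed.

Lemma row_consP n (z w : 'rV[R]_n.+1) :
  z 0 0 = w 0 0 -> behead_row z = behead_row w -> z = w.
Proof. by move=> z0 z1; rewrite -[z]cons_rowK -[w]cons_rowK z0 z1. Qed.

(** Integrating the tail first, a shear of the tail is a translation in each
section; [f] may be an arbitrary function because only sections are shifted.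
Translation invariance in dimension n is a hypothesis because this lemma serves
to prove it in dimension n+1. *)
Lemma vol_upper_shear n (f : R -> 'rV[R]_n) (A : set 'rV[R]_n.+1) :
  (forall (b : 'rV[R]_n) B, measurable B -> vol [set x | B (x + b)] = vol B) ->
  measurable A ->
  vol [set z : 'rV[R]_n.+1 | A (cons_row (z 0 0, behead_row z + f (z 0 0)))] = vol A.
Proof.
move=> IH mA /=; apply: eq_integral => x _.
rewrite -(IH (f x) [set y | A (cons_row (x, y))]); last exact: measurable_section.
congr vol; apply/seteqP; split => y /=.
  by rewrite -/(cons_row (x, y)) cons_row0 cons_row_behead.
by rewrite -/(cons_row (x, y)) cons_row0 cons_row_behead.
Qed.

(** Here the head coordinate is integrated first, so that each section is a
translated set of real numbers. *)
Lemma vol_lower_shear n (g : 'rV[R]_n -> R) (A : set 'rV[R]_n.+1) :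
  measurable_fun [set: 'rV[R]_n] g -> measurable A ->
  vol [set z : 'rV[R]_n.+1 | A (cons_row (z 0 0 + g (behead_row z), behead_row z))] = vol A.
Proof.
move=> mg mA; rewrite !vol_rsections//; last first.
  apply: measurable_preimage => // i.
  case: (unliftP 0 i) => [j ->|->].
    under eq_fun do rewrite cons_rowS /= behead_rowE; exact: measurable_coord.
  under eq_fun do rewrite cons_row0 /=; apply: measurable_funD => /=.
    exact: measurable_coord.
  exact: (measurableT_comp mg (@measurable_behead_row R n)).
apply: eq_integral => y _ /=.
under eq_set do rewrite cons_row0 cons_row_behead.
exact: (lebesgue_measure_shift (g y) (measurable_rsection y mA)).
Qed.

Lemma vol_scale_head n (a : R) (A : set 'rV[R]_n.+1) :
  a != 0 -> measurable A ->
  vol [set z : 'rV[R]_n.+1 | A (cons_row (a * z 0 0, behead_row z))] = (`|a|^-1%:E * vol A)%E.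
Proof.
move=> a0 mA; rewrite !vol_rsections//; last first.
  apply: measurable_preimage => // i.
  case: (unliftP 0 i) => [j ->|->].
    under eq_fun do rewrite cons_rowS /= behead_rowE; exact: measurable_coord.
  under eq_fun do rewrite cons_row0 /=; apply: measurable_funM => //=.
  exact: measurable_coord.
rewrite -ge0_integralZl//=; last first.
  have := measurable_fun_ysection lam (measurable_cons_row_preimage mA).
  set B := (X in measurable_fun _ X -> _); set C := (X in _ -> measurable_fun _ X).
  suff -> : B = C by [].
  apply/funext => y; rewrite /B/C/=; congr (lam _).
  by apply/seteqP; split=> x; rewrite /ysection/= inE.
apply: eq_integral => y _ /=.
under eq_set do rewrite cons_row0 cons_row_behead.
exact: (lebesgue_measure_scale a0 (measurable_rsection y mA)).
Qed.

(** A translation of R^(n+1) is an upper shear followed by a lower one, both by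
constant functions. *)
Lemma vol_shift n (b : 'rV[R]_n) (A : set 'rV[R]_n) : measurable A ->
  vol [set x | A (x + b)] = vol A.
Proof.
elim: n b A => [|n IH] b A mA.
  rewrite /= !indicE; congr ((nat_of_bool _)%:R%:E).
  by apply/idP/idP; rewrite !inE /= [b]thinmx0 addr0.
rewrite -(vol_upper_shear (fun=> behead_row b) IH mA).
set B := (X in _ = vol X).
have mB : measurable B.
  apply: measurable_preimage => // i.
  case: (unliftP 0 i) => [j ->|->].
    under eq_fun do rewrite cons_rowS /= !mxE.
    by apply: measurable_funD => //; exact: measurable_coord.
  by under eq_fun do rewrite cons_row0 /=; exact: measurable_coord.
rewrite -(vol_lower_shear (g := fun=> b 0 0) _ mB) //.
congr vol; apply/seteqP; split=> x; rewrite /B/= cons_row0 cons_row_behead /=.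
  suff -> : x + b = cons_row (x 0 0 + b 0 0, behead_row x + behead_row b) by [].
  by apply: row_consP; rewrite ?cons_row0 ?cons_row_behead ?mxE//= /behead_row linearD.
suff <- : x + b = cons_row (x 0 0 + b 0 0, behead_row x + behead_row b) by [].
by apply: row_consP; rewrite ?cons_row0 ?cons_row_behead ?mxE//= /behead_row linearD.
Qed.

Definition vol_scales n (M : 'M[R]_n) := forall A : set 'rV[R]_n, measurable A ->
  vol [set x | A (x *m M)] = (`|\det M |^-1%:E * vol A)%E.

Lemma vol_scalesM n (M N : 'M[R]_n) :
  vol_scales M -> vol_scales N -> vol_scales (M *m N).
Proof.
move=> hM hN A mA; under eq_set do rewrite mulmxA.
rewrite (hM [set y | A (y *m N)]); last exact: measurable_linear.
by rewrite hN// muleA -EFinM det_mulmx normrM invfM.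
Qed.

Lemma cons_row_mul_block n (z : measurableTypeR R * 'rV[R]_n) (a : R)
    (b : 'rV[R]_n) (c : 'cV[R]_n) (D : 'M[R]_n) :
  cons_row z *m (block_mx a%:M b c D : 'M[R]_(1 + n)) =
  cons_row ((z.1 : R) * a + (z.2 *m c) 0 0, (z.1 : R) *: b + z.2 *m D).
Proof.
rewrite [LHS](@mul_row_block _ 1 1 n 1 n) -scalar_mxM !mul_scalar_mx.
rewrite /cons_row; congr row_mx.
by apply/matrixP => i j; rewrite !ord1 !mxE eqxx !mulr1n.
Qed.

Lemma vol_scales_upper n (b : 'rV[R]_n) :
  vol_scales (block_mx 1%:M b 0 1%:M : 'M[R]_(1 + n)).
Proof.
move=> A mA; rewrite det_ublock !det1 mulr1 normr1 invr1 mul1e.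
rewrite -(vol_upper_shear (fun x => x *: b) (@vol_shift n) mA).
congr vol; apply/funext => x /=; congr A; rewrite -[in LHS](cons_rowK x).
by rewrite cons_row_mul_block mulmx0 mxE !mulmx1 /= mulr1 addr0 addrC.
Qed.

Lemma vol_scales_lower n (c : 'cV[R]_n) :
  vol_scales (block_mx 1%:M 0 c 1%:M : 'M[R]_(1 + n)).
Proof.
move=> A mA; rewrite det_lblock !det1 mulr1 normr1 invr1 mul1e.
rewrite -(vol_lower_shear (g := fun y => (y *m c) 0 0) _ mA); last first.
  under eq_fun do rewrite mxE.
  apply: measurable_sum => j; apply: measurable_funM => //.
  exact: measurable_coord.
congr vol; apply/funext => x /=; congr A; rewrite -[in LHS](cons_rowK x).
by rewrite cons_row_mul_block scaler0 !mulmx1 /= mulr1 add0r.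
Qed.

Lemma vol_scales_diag n (a : R) (D : 'M[R]_n) : a != 0 -> vol_scales D ->
  vol_scales (block_mx a%:M 0 0 D : 'M[R]_(1 + n)).
Proof.
move=> a0 hD A mA; rewrite det_ublock det_scalar1 normrM.
rewrite (_ : `|a| * `|\det D| = `|\det D| * `|a|); last by rewrite mulrC.
rewrite invfM EFinM -muleA.
pose B : set 'rV[R]_n.+1 := [set z : 'rV[R]_n.+1 | A (cons_row (z 0 0, behead_row z *m D))].
have mB : measurable B.
  apply: measurable_preimage => // i.
  case: (unliftP 0 i) => [j ->|->].
    under eq_fun do rewrite cons_rowS /= mxE.
    apply: measurable_sum => k; apply: measurable_funM => //.
    by under eq_fun do rewrite behead_rowE; exact: measurable_coord.
  by under eq_fun do rewrite cons_row0 /=; exact: measurable_coord.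
rewrite [LHS](_ : _ = vol [set z : 'rV[R]_n.+1 | B (cons_row (a * z 0 0, behead_row z))]).
  rewrite (vol_scale_head a0 mB) muleCA; congr (_ * _)%E.
  have msec x : measurable [set y | A (cons_row (x, y))] by exact: measurable_section.
  transitivity (\int[lam]_x (`|\det D |^-1%:E * vol [set y | A (cons_row (x, y))]))%E.
    apply: eq_integral => x _; rewrite -hD//.
    congr vol; apply/funext => y; rewrite /B /= -/(cons_row (x, y)).
    by rewrite cons_row0 cons_row_behead.
  rewrite ge0_integralZl//=.
  - have := measurable_fun_xsection (volm R n) (measurable_cons_row_preimage mA).
    set F := (X in measurable_fun _ X -> _); set G := (X in _ -> measurable_fun _ X).
    suff -> : F = G by [].
    apply/funext => x; rewrite /F/G/= volE//; congr (volm _ _ _).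
    by apply/seteqP; split=> y; rewrite /xsection/= inE.
  - by move=> x _; rewrite volE.
congr vol; apply/funext => x; rewrite /B /= cons_row0 cons_row_behead /=.
congr A; rewrite -[in LHS](cons_rowK x) cons_row_mul_block scaler0 mulmx0 mxE /=.
by rewrite addr0 add0r mulrC.
Qed.

Lemma vol_scales1 n : vol_scales (1%:M : 'M[R]_n).
Proof.
move=> A mA; under eq_set do rewrite mulmx1.
by rewrite det1 normr1 invr1 mul1e.
Qed.

(** Induction on the dimension.  If the corner entry [a] of the matrix is nonzero,
eliminating its row and column writes the matrix as a lower shear times
diag(a, S) times an upper shear, where S is the Schur complement.  A zero corner
entry is first made nonzero by adding another row to the first one, which is
again a shear. *)
Theorem vol_linear n (M : 'M[R]_n) : M \in unitmx -> vol_scales M.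
Proof.
elim: n M => [|n IH] M uM.
  suff -> : M = 1%:M by exact: vol_scales1.
  by apply/matrixP => -[].
pose N : 'M[R]_(1 + n) := M.
suff H (K : 'M[R]_(1 + n)) : K \in unitmx -> K 0 0 != 0 -> vol_scales K.
  have [M00|] := eqVneq (N 0 0) 0; last exact: H.
  have [i Ni0] : exists i : 'I_n, N (lift 0 i) 0 != 0.
    apply/existsP; rewrite -negb_forall; apply/negP => /forallP M0.
    move: uM; rewrite unitmxE (expand_det_col M 0) big1 ?unitr0// => i _.
    case: (unliftP 0 i) => [j ->|->]; last by rewrite M00 mul0r.
    by move: (M0 j) => /eqP ->; rewrite mul0r.
  pose E (s : R) : 'M[R]_(1 + n) := block_mx 1%:M (s *: delta_mx 0 i) 0 1%:M.
  have -> : M = E (-1) *m (E 1 *m N).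
    rewrite mulmxA /E mulmx_block !mulmx0 !mul0mx !mul1mx !mulmx1 !addr0 add0r.
    by rewrite -scalerDl subrr scale0r -scalar_mx_block mul1mx.
  apply: vol_scalesM; first exact: vol_scales_upper.
  apply: H.
    rewrite unitmx_mul uM andbT unitmxE det_ublock !det1 mulr1; exact: unitr1.
  suff -> : (E 1 *m N) 0 0 = N (lift 0 i) 0 by [].
  have E1 (j : 'I_n) : E 1 0 (lift 0 j) = (j == i)%:R.
    have -> : lift 0 j = rshift 1 j by exact: val_inj.
    rewrite [X in E 1 X](_ : _ = lshift n (ord0 : 'I_1)); last exact: val_inj.
    by rewrite /E block_mxEur scale1r mxE eqxx /= eq_sym.
  rewrite mxE big_ord_recl M00 mulr0 add0r (bigD1 i)//= big1 ?addr0.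
    by rewrite E1 eqxx mul1r.
  by move=> j ji; rewrite E1 (negPf ji) mul0r.
move=> uK K0.
pose a := K 0 0; pose b : 'rV[R]_n := ursubmx K; pose c : 'cV[R]_n := dlsubmx K.
(* Schur complement of the corner entry *)
pose S : 'M[R]_n := drsubmx K - a^-1 *: (c *m b).
have EK : K = block_mx 1%:M 0 (a^-1 *: c) 1%:M *m
          (block_mx a%:M 0 0 S *m block_mx 1%:M (a^-1 *: b) 0 1%:M).
  rewrite !mulmx_block !mulmx0 !mul0mx !mul1mx !mulmx1 !addr0 !add0r.
  rewrite !mul_scalar_mx !mul_mx_scalar !scalerA divff// !scale1r -[LHS]submxK.
  congr block_mx.
    by apply/matrixP => i j; rewrite !ord1 !mxE mulr1n; congr (K _ _); apply/val_inj.
  by rewrite /S addrC -scalemxAl subrK.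
have uS : S \in unitmx.
  move: uK; rewrite EK !unitmx_mul => /and3P[_ + _].
  rewrite !unitmxE det_ublock det_scalar1 unitrM => /andP[_ ->] //.
rewrite EK; apply: vol_scalesM; first exact: vol_scales_lower.
apply: vol_scalesM; last exact: vol_scales_upper.
exact: vol_scales_diag (IH _ uS).
Qed.

Theorem vol_affine n (M : 'M[R]_n) (b : 'rV[R]_n) (A : set 'rV[R]_n) :
  M \in unitmx -> measurable A ->
  vol [set x | A (x *m M + b)] = (`|\det M |^-1%:E * vol A)%E.
Proof.
move=> uM mA; rewrite (vol_linear uM (A := [set y | A (y + b)])).
  by rewrite vol_shift.
by have := measurable_affine 1%:M b mA; under eq_set do rewrite mulmx1.
Qed.

End VolumeLinear.

(** * Volume of the corner simplex *)

Section Corner.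
Variable R : realType.
Notation lam := (@lebesgue_measure R).

(** Two versions of the simplex spanned by 0 and t e_1, ..., t e_n.  The closed
ones cover the polytope and those with positive coordinates are disjoint; as
both have the same volume, no argument about overlaps of measure zero is needed
below. *)
Definition corner_simplex (closed : bool) n (t : R) : set 'rV[R]_n :=
  [set x | (forall i, 0 < x 0 i ?<= if closed) /\ \sum_i x 0 i <= t].

Lemma measurable_corner_simplex closed n t : measurable (@corner_simplex closed n t).
Proof.
rewrite (_ : corner_simplex _ _ = (\bigcap_(i : 'I_n) [set x | 0 < x 0 i ?<= if closed]) `&`
  [set x | \sum_i x 0 i <= t]); last first.
  by apply/seteqP; split=> x [x0 xt]; split => // i; [move=> _|]; exact: x0.
apply: measurableI.
  apply: fin_bigcap_measurable => // i _.
  have := @measurable_coord R n i measurableT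
    [set` Interval (BSide closed (0:R)) +oo%O] (measurable_itv _).
  rewrite setTI; set B := (X in _ -> measurable X); set C := (X in measurable X -> _).
  by suff -> : B = C by [];
    apply/seteqP; split=> x; rewrite /B/C/= in_itv/= andbT.
have ms : measurable_fun [set: 'rV[R]_n] (fun x : 'rV[R]_n => \sum_i x 0 i).
  by apply: measurable_sum => i; exact: measurable_coord.
have := ms measurableT `]-oo, t]%classic (measurable_itv _).
rewrite setTI; set B := (X in _ -> measurable X); set C := (X in measurable X -> _).
by suff -> : B = C by []; apply/seteqP; split=> x; rewrite /B/C/= in_itv/=.
Qed.

(** Fundamental theorem of calculus; the left end of the interval is immaterial
because points are null sets. *)
Lemma integral_powerB closed n (t : R) : 0 <= t ->
  (\int[lam]_(x in [set` Interval (BSide closed 0%R) (BRight t)])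
     ((t - x) ^+ n / n`!%:R)%:E = (t ^+ n.+1 / (n.+1)`!%:R)%:E)%E.
Proof.
move=> t0; set f := fun x : R => (t - x) ^+ n / n`!%:R.
pose c : R := - (n.+1)`!%:R^-1.
pose g : R -> R := cst t - id.
pose F : R -> R := c *: (g ^+ n.+1).
have FE x : F x = - ((t - x) ^+ n.+1 / (n.+1)`!%:R).
  by rewrite /F /c fctE scaleNr; congr (- _); rewrite mulrC.
have dF (x : R) : is_derive x (1 : R) F (f x).
  apply: is_derive_eq.
  have n0 : (n`!%:R : R) != 0 by rewrite pnatr_eq0 -lt0n fact_gt0.
  have n1 : (n.+1%:R : R) != 0 by rewrite pnatr_eq0.
  rewrite /c /f /g /GRing.scale /= factS natrM fctE.
  by field; rewrite n0 nat1r.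
have cF (y : R) : {for y, continuous F}.
  apply: differentiable_continuous; apply/derivable1_diffP; exact: ex_derive.
have cf : continuous f.
  move=> x; have -> : f = n`!%:R^-1 *: (g ^+ n).
    by apply/funext => y; rewrite /f /g fctE mulrC.
  by apply: differentiable_continuous; apply/derivable1_diffP; exact: ex_derive.
have mf D : measurable_fun D (EFin \o f).
  apply/measurable_EFinP; apply: (measurable_funS measurableT) => //.
  exact: continuous_measurable_fun.
have -> : (\int[lam]_(x in [set` Interval (BSide closed 0%R) (BRight t)]) (f x)%:E =
   \int[lam]_(x in `[0%R, t]) (f x)%:E)%E.
  case: closed => //; exact: (integral_itv_obnd_cbnd (f := EFin \o f)).
move: t0; rewrite le_eqVlt => /predU1P[<-|t0].
  by rewrite set_itv1 integral_set1 expr0n mul0r.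
rewrite (@continuous_FTC2 _ _ F)//.
- by rewrite !FE subrr subr0 expr0n mul0r oppr0 -EFinB sub0r opprK.
- by apply: continuous_subspaceT => x; exact: cf.
- split.
  + by move=> x _; exact: ex_derive.
  + by apply: cvg_at_right_filter; exact: cF.
  + by apply: cvg_at_left_filter; exact: cF.
- by move=> x _; rewrite derive1E; exact: derive_val.
Qed.

(** The section at head coordinate x is the corner simplex of size t - x. *)
Theorem vol_corner_simplex closed n (t : R) : 0 <= t ->
  vol (@corner_simplex closed n t) = (t ^+ n / n`!%:R)%:E.
Proof.
elim: n t => [|n IH] t t0.
  rewrite /= expr0 divr1 indicE mem_set //; split; first by case.
  by rewrite big_ord0.
rewrite -(integral_powerB closed n t0) integral_mkcond /=.
apply: eq_integral => x _; rewrite patchE.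
have E : [set y : 'rV[R]_n | corner_simplex closed t (cons_row (x, y))] =
    if 0 < x ?<= if closed then corner_simplex closed (t - x) else set0.
  apply/seteqP; split=> y; rewrite /corner_simplex /=.
    move=> [y0]; rewrite big_ord_recl cons_row0 => yt.
    have := y0 0; rewrite cons_row0 => ->; split.
      by move=> i; have := y0 (lift 0 i); rewrite cons_rowS.
    by rewrite lerBrDl; under eq_bigr do rewrite -(cons_rowS (x, y)).
  case: ifP => // x0 [y0 yt]; split.
    by move=> i; case: (unliftP 0 i) => [j ->|->]; rewrite ?cons_rowS ?cons_row0.
  rewrite big_ord_recl cons_row0 -lerBrDl.
  by under eq_bigr do rewrite cons_rowS.
rewrite -[X in vol X]/[set y : 'rV[R]_n | corner_simplex closed t (cons_row (x, y))] E.
rewrite mem_setE /= in_itv/=; case: ifPn => x0 /=; last first.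
  by rewrite volE ?measure0 .
have [xt|xt] := leP x t; first by rewrite IH // subr_ge0.
rewrite (_ : corner_simplex _ _ = set0) ?volE ?measure0 //.
apply/seteqP; split => // y [y0 yt].
have : t - x < 0 by rewrite subr_lt0.
rewrite ltNge => /negP; apply; apply: le_trans yt; apply: sumr_ge0 => i _.
by have := y0 i; rewrite /Order.lteif; case: ifP => // _; exact: ltW.
Qed.

End Corner.

(** * Convex combinations *)

Section Dotp.
Variables (R : realType) (d : nat).
Implicit Types (u v w : 'rV[R]_d).

Lemma dotpE u v : dotp u v = (u *m v^T) 0 0.
Proof. by rewrite /dotp mxE; apply: eq_bigr => i _; rewrite mxE. Qed.

Lemma dotpC u v : dotp u v = dotp v u.
Proof. by apply: eq_bigr => i _; rewrite mulrC. Qed.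

Lemma dotpDl u w v : dotp (u + w) v = dotp u v + dotp w v.
Proof. by rewrite !dotpE mulmxDl mxE. Qed.

Lemma dotpZl a u v : dotp (a *: u) v = a * dotp u v.
Proof. by rewrite !dotpE -scalemxAl mxE. Qed.

Lemma dotp0l v : dotp 0 v = 0.
Proof. by rewrite !dotpE mul0mx mxE. Qed.

Lemma dotpZr a u v : dotp v (a *: u) = a * dotp v u.
Proof. by rewrite !(dotpC v) dotpZl. Qed.

Lemma dotp0r v : dotp v 0 = 0.
Proof. by rewrite dotpC dotp0l. Qed.

Lemma dotp_mulmxl n (c : 'rV[R]_n) (V : 'M[R]_(n, d)) v :
  dotp (c *m V) v = \sum_i c 0 i * dotp (row i V) v.
Proof.
rewrite dotpE -mulmxA mxE; apply: eq_bigr => i _.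
by rewrite dotpE -row_mul [in RHS]mxE.
Qed.

Lemma dotp_mulmxr n (c : 'rV[R]_n) (V : 'M[R]_(n, d)) v :
  dotp v (c *m V) = \sum_i c 0 i * dotp v (row i V).
Proof. by rewrite dotpC dotp_mulmxl; apply: eq_bigr => i _; rewrite dotpC. Qed.

Lemma dotpvv0 v : dotp v v = 0 -> v = 0.
Proof.
rewrite /dotp => /eqP; rewrite psumr_eq0; last by move=> i _; rewrite -expr2 sqr_ge0.
move=> /allP v0; apply/rowP => i; rewrite mxE.
have := v0 i; rewrite mem_index_enum => /(_ isT).
by rewrite -expr2 sqrf_eq0 => /eqP.
Qed.

End Dotp.

Section Convex.
Variables (R : realType) (d : nat).

Definition convex_coef n (c : 'rV[R]_n) :=
  (forall i, 0 <= c 0 i) /\ \sum_i c 0 i = 1.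

(** The rows are extreme points of their convex hull, and are distinct: the only
convex combination of the rows which gives row k is the trivial one. *)
Definition irredundant n (V : 'M[R]_(n, d)) := forall k c,
  convex_coef c -> c *m V = row k V -> c = delta_mx 0 k.

Lemma conv_hullP n (V : 'M[R]_(n, d)) x :
  conv_hull V x <-> exists2 c, convex_coef c & x = c *m V.
Proof.
split=> [[c [c0 c1 ->]]|[c [c0 c1] ->]]; first by exists c; [split|].
by exists c; split.
Qed.

Lemma convex_coef_delta n (k : 'I_n) : convex_coef (delta_mx 0 k).
Proof.
split=> [i|]; first by rewrite mxE ler0n.
rewrite (bigD1 k)//= big1 ?addr0 ?mxE ?eqxx// => i ik.
by rewrite mxE (negPf ik) andbF.
Qed.

Lemma conv_hull_row n (V : 'M[R]_(n, d)) k : conv_hull V (row k V).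
Proof.
by apply/conv_hullP; exists (delta_mx 0 k); [exact: convex_coef_delta|rewrite -rowE].
Qed.

Lemma convex_coefM m n (c : 'rV[R]_m) (A : 'M[R]_(m, n)) :
  convex_coef c -> (forall i, 0 < c 0 i -> convex_coef (row i A)) ->
  convex_coef (c *m A).
Proof.
move=> [c0 c1] hA.
have E i (k : R) : (0 < c 0 i -> k = 1) -> c 0 i * k = c 0 i.
  move=> H; have := c0 i; rewrite le_eqVlt => /predU1P[<-|/H ->].
    by rewrite mul0r.
  by rewrite mulr1.
split=> [j|].
  rewrite mxE; apply: sumr_ge0 => i _.
  have := c0 i; rewrite le_eqVlt => /predU1P[<-|ci]; first by rewrite mul0r.
  by rewrite mulr_ge0// ?c0//; have [/(_ j)] := hA i ci; rewrite mxE.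
under eq_bigr do rewrite mxE.
rewrite exchange_big /= -[RHS]c1; apply: eq_bigr => i _.
rewrite -mulr_sumr; apply: E => /hA[_ <-].
by apply: eq_bigr => j _; rewrite mxE.
Qed.

(** An average of numbers at most b which equals b only involves numbers equal
to b. *)
Lemma convex_coef_pos n (c : 'rV[R]_n) (f : 'I_n -> R) (b : R) :
  convex_coef c -> (forall i, f i <= b) -> \sum_i c 0 i * f i = b ->
  forall i, 0 < c 0 i -> f i = b.
Proof.
move=> [c0 c1] fb E i ci.
have : \sum_i c 0 i * (b - f i) = 0.
  under eq_bigr do rewrite mulrBr.
  by rewrite sumrB -mulr_suml c1 mul1r E subrr.
move/eqP; rewrite psumr_eq0; last by move=> j _; rewrite mulr_ge0// subr_ge0.
move/allP => /(_ i); rewrite mem_index_enum => /(_ isT).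
by rewrite mulf_eq0 gt_eqF//= subr_eq0 => /eqP.
Qed.

Lemma convex_coef_le n (c : 'rV[R]_n) (f : 'I_n -> R) (b : R) :
  convex_coef c -> (forall i, f i <= b) -> \sum_i c 0 i * f i <= b.
Proof.
move=> [c0 c1] fb; rewrite -[leRHS]mul1r -c1 mulr_suml.
by apply: ler_sum => i _; exact: ler_wpM2l.
Qed.

Lemma convex_coef_eq_delta n (c : 'rV[R]_n) k : convex_coef c -> c 0 k = 1 ->
  c = delta_mx 0 k.
Proof.
move=> [c0 c1] ck; apply/rowP => i; rewrite mxE eqxx /=.
have [->|ik] := eqVneq i k; first by rewrite ck.
move: c1; rewrite (bigD1 k)//= ck -[RHS]addr0 => /addrI /eqP.
by rewrite psumr_eq0// => /allP/(_ i); rewrite mem_index_enum ik => /(_ isT)/eqP.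
Qed.

(** Drop rows which are convex combinations of the others until none is left. *)
Lemma irredundant_generators (S P : set 'rV[R]_d) :
  (exists n (V : 'M[R]_(n, d)), (forall i, S (row i V)) /\ P = conv_hull V) ->
  exists n (V : 'M[R]_(n, d)),
    [/\ forall i, S (row i V), P = conv_hull V & irredundant V].
Proof.
move=> [n]; elim: n => [|n IH] [V [SV PV]].
  by exists 0, V; split => // -[].
have [irr|] := pselect (irredundant V); first by exists n.+1, V.
move=> /existsNP[k] /existsNP[c] /not_implyP[cc] /not_implyP[cV cd].
have ck1 : c 0 k < 1.
  rewrite lt_neqAle; apply/andP; split.
    by apply/eqP => /(convex_coef_eq_delta cc).
  rewrite -cc.2 (bigD1 k)//= lerDl; apply: sumr_ge0 => i _; exact: cc.1.
pose V' := row' k V.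
have rowV' i : row i V' = row (lift k i) V by apply/rowP => j; rewrite !mxE.
apply: IH; exists V'; split; first by move=> i; rewrite rowV'.
rewrite PV; apply/seteqP; split=> x /conv_hullP[a ca ->]; apply/conv_hullP; last first.
  pose b : 'rV[R]_n.+1 := \row_i (if unlift k i is Some j then a 0 j else 0).
  have bE i : b 0 (lift k i) = a 0 i by rewrite mxE liftK.
  have b0 : b 0 k = 0 by rewrite mxE unlift_none.
  exists b.
    split=> [i|]; first by rewrite mxE; case: unlift => // j; exact: ca.1.
    by rewrite (bigD1_ord k)//= b0 add0r; under eq_bigr do rewrite bE; exact: ca.2.
  rewrite !mulmx_sum_row (bigD1_ord k)//= b0 scale0r add0r.
  by apply: eq_bigr => i _; rewrite bE rowV'.
have pk : 0 < 1 - c 0 k by rewrite subr_gt0.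
have sk : \sum_i c 0 (lift k i) = 1 - c 0 k.
  by apply/eqP; rewrite eq_sym subr_eq -cc.2 (bigD1_ord k)//= addrC.
exists (\row_i (a 0 (lift k i) + a 0 k * (c 0 (lift k i) / (1 - c 0 k)))).
  split=> [i|].
    by rewrite mxE addr_ge0 ?ca.1// mulr_ge0 ?ca.1// divr_ge0 ?cc.1// ltW.
  under eq_bigr do rewrite mxE.
  rewrite big_split /= -mulr_sumr -mulr_suml sk divff ?gt_eqF// mulr1.
  by rewrite -ca.2 (bigD1_ord k)//= addrC.
have Vk : row k V = \sum_i (c 0 (lift k i) / (1 - c 0 k)) *: row (lift k i) V.
  have : row k V - c 0 k *: row k V = \sum_i c 0 (lift k i) *: row (lift k i) V.
    by apply/eqP; rewrite subr_eq -{1}cV mulmx_sum_row (bigD1_ord k)//= addrC.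
  rewrite -{1}[row k V]scale1r -scalerBl => /(congr1 (fun z => (1 - c 0 k)^-1 *: z)).
  rewrite scalerA mulVf ?gt_eqF// scale1r => ->.
  by rewrite scaler_sumr; apply: eq_bigr => i _; rewrite scalerA mulrC.
rewrite !mulmx_sum_row (bigD1_ord k)//= {1}Vk scaler_sumr -big_split /=.
by apply: eq_bigr => i _; rewrite mxE rowV' scalerA -scalerDl addrC.
Qed.

(** Perturbation: finitely many strict inequalities survive a small step in any
direction. *)
Lemma small_step n (a b : 'I_n -> R) :
  exists2 e, 0 < e & forall k, a k < 1 -> a k + e * b k < 1.
Proof.
pose s := \sum_(k | a k < 1) `|b k| / (1 - a k).
have s0 : 0 <= s.
  by apply: sumr_ge0 => k ak; rewrite divr_ge0// subr_ge0 ltW.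
have s1 : 0 < 1 + s by rewrite ltr_wpDr.
(* each |b k| / (1 - a k) is at most s, hence less than 1 + s *)
exists (1 + s)^-1; first by rewrite invr_gt0.
move=> k ak; have pk : 0 < 1 - a k by rewrite subr_gt0.
rewrite -ltrBrDl; apply: le_lt_trans (_ : (1 + s)^-1 * `|b k| < _).
  by rewrite ler_wpM2l ?ler_norm// invr_ge0 ltW.
rewrite mulrC ltr_pdivrMr// mulrC -ltr_pdivrMr//.
rewrite /s (bigD1 k)//=; set r := (X in _ + (_ + X)).
have : 0 <= r.
  by apply: sumr_ge0 => i /andP[ai _]; rewrite divr_ge0// subr_ge0 ltW.
lra.
Qed.

End Convex.

Section Interior.
Variables (R : realType) (d : nat).

Lemma interior_scale (P : set 'rV[R]_d) (a : 'rV[R]_d) : P° 0 ->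
  exists2 t, 0 < t & P (t *: a).
Proof.
rewrite /interior => /nbhs_ballP[e /= e0 eP].
pose s := \sum_i `|a 0 i|.
have s0 : 0 <= s by apply: sumr_ge0.
have s1 : 0 < 1 + s by rewrite ltr_wpDr.
exists (e / (1 + s)); first by rewrite divr_gt0.
apply: eP; split=> // i j; rewrite !mxE /ball /= sub0r normrN normrM ord1.
rewrite gtr0_norm ?divr_gt0// mulrAC ltr_pdivrMr// ltr_pM2l//.
rewrite /s (bigD1 j)//=; set r := (X in _ + (_ + X)).
have : 0 <= r by apply: sumr_ge0.
lra.
Qed.

(** P contains a positive multiple of [a], on which the functional is positive. *)
Lemma supporting_gt0 (P : set 'rV[R]_d) a b : P° 0 -> a != 0 ->
  (forall x, P x -> dotp a x <= b) -> 0 < b.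
Proof.
move=> P0 a0 ab; have [t t0 /ab] := interior_scale a P0.
rewrite dotpZr; apply: lt_le_trans; rewrite mulr_gt0// lt_neqAle.
rewrite eq_sym; apply/andP; split.
  by apply: contra_neq a0; exact: dotpvv0.
by apply: sumr_ge0 => i _; rewrite -expr2 sqr_ge0.
Qed.

End Interior.

(** * Vectors supported on selected coordinates *)

Lemma row_free_inj (F : fieldType) m d (V : 'M[F]_(m, d)) :
  (forall c : 'rV_m, c *m V = 0 -> c = 0) -> row_free V.
Proof.
move=> h; rewrite -kermx_eq0; apply/eqP/row_matrixP => r; rewrite row0.
by apply: h; rewrite -row_mul mulmx_ker row0.
Qed.

Section Scatter.
Variables (F : fieldType) (m n : nat) (s : 'I_m -> 'I_n).
Hypothesis s_inj : injective s.

Definition scatter (c : 'rV[F]_m) : 'rV[F]_n := c *m \matrix_i delta_mx 0 (s i).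

Lemma scatterE c k : scatter c 0 k = \sum_i c 0 i * (k == s i)%:R.
Proof. by rewrite mxE; apply: eq_bigr => i _; rewrite !mxE eqxx. Qed.

Lemma scatter_at c i : scatter c 0 (s i) = c 0 i.
Proof.
rewrite scatterE (bigD1 i)//= eqxx mulr1 big1 ?addr0// => l li.
by rewrite (inj_eq s_inj) eq_sym (negPf li) mulr0.
Qed.

Lemma scatter_out c k : (forall i, k != s i) -> scatter c 0 k = 0.
Proof. by move=> ks; rewrite scatterE big1// => i _; rewrite (negPf (ks i)) mulr0. Qed.

Lemma scatter_eq0 c : scatter c = 0 -> c = 0.
Proof. by move=> c0; apply/rowP => i; rewrite -scatter_at c0 !mxE. Qed.

Lemma scatter_sum c : \sum_k scatter c 0 k = \sum_i c 0 i.
Proof.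
under eq_bigr do rewrite scatterE.
rewrite exchange_big /=; apply: eq_bigr => i _.
rewrite (bigD1 (s i))//= eqxx mulr1 big1 ?addr0// => k /negPf ->.
by rewrite mulr0.
Qed.

Lemma scatter_mul p (U : 'M[F]_(n, p)) c : scatter c *m U = c *m rowsub s U.
Proof.
rewrite -mulmxA; congr (_ *m _); apply/row_matrixP => i.
by rewrite row_mul rowK -rowE row_rowsub.
Qed.

End Scatter.

(** * Vertices and facets of a reflexive simplicial polytope *)

Lemma int_lattice_mx (R : realType) d n (V : 'M[R]_(n, d)) :
  (forall i, @int_lattice R d (row i V)) -> exists Z : 'M[int]_(n, d), V = map_mx intr Z.
Proof.
move=> VL; have /choice[z zV] : forall i, exists z : 'rV[int]_d, map_mx intr z = row i V.
  by move=> i; have [z _ <-] := VL i; exists z.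
exists (\matrix_i z i); apply/row_matrixP => i.
by rewrite -map_row rowK zV.
Qed.

Lemma int_lattice_map (R : realType) d n (Z : 'M[int]_(n, d)) i :
  @int_lattice R d (row i (map_mx intr Z)).
Proof. by exists (row i Z) => //; rewrite map_row. Qed.

(** Integral generators of P and of its dual, in both cases without superfluous
ones.  The rows of [vert] are the vertices of P and, when P is simplicial, those
of [normal] are the normals of its facets. *)
Record dual_pair (R : realType) d (P : set 'rV[R]_d) := DualPair {
  nv : nat;
  nf : nat;
  vert : 'M[int]_(nv, d);
  normal : 'M[int]_(nf, d);
  vertE : P = conv_hull (map_mx intr vert);
  normalE : dual P = conv_hull (map_mx intr normal);
  vert_irr : irredundant (map_mx intr vert : 'M[R]_(nv, d));
  normal_irr : irredundant (map_mx intr normal : 'M[R]_(nf, d)) }.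

Lemma lattice_polytope_irredundant (R : realType) d (P : set 'rV[R]_d) :
  lattice_polytope P -> exists n (Z : 'M[int]_(n, d)),
    P = conv_hull (map_mx intr Z) /\ irredundant (map_mx intr Z : 'M[R]_(n, d)).
Proof.
move=> /irredundant_generators[n [V [/int_lattice_mx[Z ->] PV irr]]].
by exists n, Z.
Qed.

Lemma dual_pair_exists (R : realType) d (P : set 'rV[R]_d) :
  lattice_polytope P -> lattice_polytope (dual P) -> inhabited (dual_pair P).
Proof.
move=> /lattice_polytope_irredundant[n [V [PV Vi]]].
move=> /lattice_polytope_irredundant[m [W [PW Wi]]].
exact: (inhabits (DualPair PV PW Vi Wi)).
Qed.

Section Fan.
Variables (R : realType) (d : nat) (P : set 'rV[R]_d) (D : dual_pair P).
Hypothesis P0 : P° 0.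

Local Notation n := (nv D).
Local Notation q := (nf D).
Local Notation U := (map_mx intr (vert D) : 'M[R]_(n, d)).
Local Notation W := (map_mx intr (normal D) : 'M[R]_(q, d)).
Implicit Types (j : 'I_q) (k : 'I_n).

Lemma polytope0 : P 0.
Proof. exact: interior_subset. Qed.

Lemma polytopeP x : P x <-> exists2 c, convex_coef c & x = c *m U.
Proof. by rewrite (congr1 (@^~ x) (vertE D)); exact: conv_hullP. Qed.

Lemma polytope_vert k : P (row k U).
Proof.
apply/polytopeP; exists (delta_mx 0 k); last by rewrite -rowE.
exact: convex_coef_delta.
Qed.

Lemma dualP (u : 'rV[R]_d) : dual P u <-> forall k, dotp u (row k U) <= 1.
Proof.
split=> [du k|uk x /polytopeP[c cc ->]]; first exact/du/polytope_vert.
by rewrite dotp_mulmxr; exact: convex_coef_le.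
Qed.

Lemma dual_normal u : dual P u <-> exists2 c, convex_coef c & u = c *m W.
Proof. by rewrite (congr1 (@^~ u) (normalE D)); exact: conv_hullP. Qed.

Lemma pairing_le1 j k : dotp (row j W) (row k U) <= 1.
Proof.
have : dual P (row j W).
  apply/dual_normal; exists (delta_mx 0 j); last by rewrite -rowE.
  exact: convex_coef_delta.
by move/dualP.
Qed.

Definition tight j : {set 'I_n} := [set k | dotp (row j W) (row k U) == 1].

Lemma tightP j k : reflect (dotp (row j W) (row k U) = 1) (k \in tight j).
Proof. by rewrite inE; exact: eqP. Qed.

Lemma not_tight j k : k \notin tight j -> dotp (row j W) (row k U) < 1.
Proof. by rewrite inE => kj; rewrite lt_neqAle kj pairing_le1. Qed.

(** A nonzero z orthogonal to all vertices on the hyperplane of w_j would leave room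
to move w_j both ways along z inside the dual, against w_j being extreme.  So
these vertices span R^d, and each normal does define a facet. *)
Lemma tight_spanning j (z : 'rV[R]_d) :
  (forall k, k \in tight j -> dotp z (row k U) = 0) -> z = 0.
Proof.
move=> zT; set w := row j W.
have [e e0 he] := small_step (fun k => dotp w (row k U)) (fun k => `|dotp z (row k U)|).
have in_dual s : `|s| = e -> dual P (w + s *: z).
  move=> se; apply/dualP => k; rewrite dotpDl dotpZl.
  have [kT|kT] := boolP (k \in tight j).
    by rewrite zT// mulr0 addr0; exact: pairing_le1.
  have := he k (not_tight kT); rewrite -se -normrM => h.
  apply: le_trans (ltW h); rewrite lerD2l; exact: ler_norm.
have /dual_normal[c cc cE] := in_dual e (gtr0_norm e0).
have /dual_normal[c' cc' cE'] : dual P (w + (- e) *: z).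
  by apply: in_dual; rewrite normrN gtr0_norm.
(* w is the midpoint of w + e z and w - e z *)
have half0 : 0 <= 2^-1 :> R by rewrite invr_ge0.
have hc : 2^-1 *: (c + c') = delta_mx 0 j.
  apply: (@normal_irr _ _ _ D).
    split=> [i|]; first by rewrite !mxE mulr_ge0// addr_ge0 ?cc.1 ?cc'.1.
    under eq_bigr do rewrite !mxE mulrDr.
    by rewrite big_split /= -!mulr_sumr cc.2 cc'.2; lra.
  rewrite -scalemxAl mulmxDl -cE -cE' scaleNr addrACA subrr addr0 -mulr2n.
  by rewrite -[w *+ 2]scaler_nat scalerA mulVf ?pnatr_eq0// scale1r.
have cj : c = delta_mx 0 j.
  apply/rowP => i; have /rowP/(_ i) := hc; rewrite !mxE eqxx /=.
  have := cc.1 i; have := cc'.1 i.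
  have [->|ij] := eqVneq i j => /=; last by lra.
  have c1 : c 0 j <= 1.
    by rewrite -cc.2 (bigD1 j)//= lerDl; apply: sumr_ge0 => l _; exact: cc.1.
  have c1' : c' 0 j <= 1.
    by rewrite -cc'.2 (bigD1 j)//= lerDl; apply: sumr_ge0 => l _; exact: cc'.1.
  lra.
move: cE; rewrite cj -rowE -/w -[RHS]addr0 => /addrI/eqP.
by rewrite scaler_eq0 gt_eqF//= => /eqP.
Qed.

Definition facet_of j : set 'rV[R]_d := [set x | P x /\ dotp (row j W) x = 1].

Lemma dual_row j : dual P (row j W).
Proof. by apply/dualP => k; exact: pairing_le1. Qed.

Lemma facet_of_face j : face P (facet_of j).
Proof. by exists (row j W), 1; split => // x Px; exact: (dual_row j). Qed.

Lemma facet_of_proper j : facet_of j <> P.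
Proof.
move=> E; have : facet_of j 0 by rewrite E; exact: polytope0.
by case=> _ /eqP; rewrite dotp0r eq_sym oner_eq0.
Qed.

(** A point of P on a supporting hyperplane is a convex combination of the
generators on this hyperplane. *)
Lemma facet_ofP j x : facet_of j x <->
  exists c, [/\ convex_coef c, forall k, k \notin tight j -> c 0 k = 0 & x = c *m U].
Proof.
split=> [[/polytopeP[c cc xE] wx]|[c [cc cT xE]]].
  exists c; split => // k; apply: contraNeq => ck; apply/tightP.
  apply: (convex_coef_pos (f := fun k => dotp (row j W) (row k U)) cc).
  - by move=> i; exact: pairing_le1.
  - by rewrite -dotp_mulmxr -xE.
  - by rewrite lt_neqAle eq_sym ck cc.1.
split; first by apply/polytopeP; exists c.
rewrite xE dotp_mulmxr -[RHS]cc.2; apply: eq_bigr => k _.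
by have [/tightP ->|/cT ->] := boolP (k \in tight j); rewrite ?mulr1// mul0r.
Qed.

Lemma facet_of_vert j k : k \in tight j -> facet_of j (row k U).
Proof. by move=> /tightP kj; split => //; exact: polytope_vert. Qed.

Hypothesis hsimp : simplicial P.

(** The facet is the hull of the affinely independent rows of some matrix V.
Express V through the generators as V = A U, and the generators on the facet
through V with coefficients B: since the generators are irredundant, B A is the
identity on the coordinates of the facet, and c U = 0 forces c B = 0, so
c = c B A = 0.  Affine independence suffices because the hyperplane of the facet
misses the origin. *)
Lemma tight_free j (c : 'rV[R]_n) :
  (forall k, k \notin tight j -> c 0 k = 0) -> c *m U = 0 -> c = 0.
Proof.
move=> cT cU.
have [m [V [Vi FV]]] := hsimp (facet_of_face j) (@facet_of_proper j).
have /choice[a aP] : forall i : 'I_m, exists c : 'rV[R]_n, [/\ convex_coef c,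
    forall k, k \notin tight j -> c 0 k = 0 & row i V = c *m U].
  by move=> i; apply/facet_ofP; rewrite FV; exact: conv_hull_row.
pose A := \matrix_i a i.
have VA : V = A *m U.
  by apply/row_matrixP => i; rewrite row_mul rowK; have [] := aP i.
have /choice[b bP] : forall k, exists b : 'rV[R]_m,
    k \in tight j -> convex_coef b /\ row k U = b *m V.
  move=> k; have [kT|_] := boolP (k \in tight j); last by exists 0.
  have := facet_of_vert kT; rewrite FV => /conv_hullP[b cb bV].
  by exists b.
pose B := \matrix_k b k.
(* irredundancy: a generator is a combination of generators in one way only *)
have BA k : k \in tight j -> row k (B *m A) = delta_mx 0 k.
  move=> kT; have [cb bV] := bP k kT; apply: (@vert_irr _ _ _ D).
    rewrite row_mul rowK; apply: convex_coefM => // i _.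
    by rewrite rowK; have [] := aP i.
  by rewrite row_mul rowK -mulmxA -VA -bV.
have ck (M : 'I_n -> R) : \sum_k c 0 k * M k = \sum_(k in tight j) c 0 k * M k.
  rewrite [LHS](bigID (fun k => k \in tight j))/= [X in _ + X]big1 ?addr0//.
  by move=> k /cT ->; rewrite mul0r.
have sc : \sum_k c 0 k = 0.
  have := congr1 (dotp (row j W)) cU; rewrite dotp0r dotp_mulmxr ck => h.
  rewrite -[RHS]h.
  transitivity (\sum_k c 0 k * 1); first by apply: eq_bigr => k _; rewrite mulr1.
  by rewrite (ck (fun=> 1)); apply: eq_bigr => k /tightP ->.
have cBA : c *m (B *m A) = c.
  apply/rowP => k; rewrite mxE ck (eq_bigr (fun l => c 0 l * (l == k)%:R)).
    rewrite -(ck (fun l => (l == k)%:R)) (bigD1 k)//= eqxx mulr1 big1 ?addr0//.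
    by move=> l /negPf ->; rewrite mulr0.
  move=> l lT; congr (_ * _); have /rowP/(_ k) := BA l lT.
  by rewrite [LHS]mxE => ->; rewrite mxE eqxx eq_sym.
rewrite -cBA mulmxA (Vi (c *m B)) ?mul0mx//.
  under eq_bigr do rewrite mxE.
  rewrite exchange_big /= -[RHS]sc; apply: eq_bigr => k _; rewrite -mulr_sumr.
  have [kT|/cT ->] := boolP (k \in tight j); last by rewrite mul0r.
  under eq_bigr do rewrite mxE.
  by have [[_ ->] _] := bP k kT; rewrite mulr1.
by rewrite VA !mulmxA -(mulmxA c B A) cBA.
Qed.

Lemma card_tight j : #|tight j| = d.
Proof.
pose s (i : 'I_#|tight j|) : 'I_n := enum_val i.
have s_inj : injective s by exact: enum_val_inj.
have fM : row_free (rowsub s U).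
  apply: row_free_inj => v vM; apply: (scatter_eq0 s_inj); apply: (@tight_free j).
    move=> k kT; apply: scatter_out => i; apply: contraNneq kT => ->.
    exact: enum_valP.
  by rewrite scatter_mul.
have fullM : row_full (rowsub s U).
  rewrite /row_full -mxrank_tr -/(row_free _); apply: row_free_inj => v vM.
  apply: (@tight_spanning j) => k kT.
  have /rowP/(_ (enum_rank_in kT k)) := vM; rewrite [RHS]mxE => <-.
  rewrite dotpE !mxE; apply: eq_bigr => i _.
  by rewrite !mxE /s enum_rankK_in.
by move: fM fullM; rewrite /row_free /row_full => /eqP -> /eqP.
Qed.

Definition corner_vert j (i : 'I_d) : 'I_n :=
  enum_val (cast_ord (esym (card_tight j)) i).

Lemma corner_vert_tight j i : corner_vert j i \in tight j.
Proof. exact: enum_valP. Qed.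

Lemma corner_vert_inj j : injective (corner_vert j).
Proof. by move=> i i' /enum_val_inj/cast_ord_inj. Qed.

Lemma corner_vertP j k : k \in tight j -> exists i, k = corner_vert j i.
Proof.
move=> kT; exists (cast_ord (card_tight j) (enum_rank_in kT k)).
by rewrite /corner_vert cast_ordK enum_rankK_in.
Qed.

Definition facet_imx j : 'M[int]_d := rowsub (corner_vert j) (vert D).
Definition facet_mx j : 'M[R]_d := map_mx intr (facet_imx j).

Lemma row_facet_mx j i : row i (facet_mx j) = row (corner_vert j i) U.
Proof. by apply/rowP => l; rewrite !mxE. Qed.

Lemma dotp_facet_mx j i : dotp (row j W) (row i (facet_mx j)) = 1.
Proof. by rewrite row_facet_mx; apply/tightP/corner_vert_tight. Qed.

Lemma facet_mx_unit j : facet_mx j \in unitmx.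
Proof.
rewrite -row_full_unit /row_full -mxrank_tr -/(row_free _).
apply: row_free_inj => v vM; apply: (@tight_spanning j) => k /corner_vertP[i ->].
have /rowP/(_ i) := vM; rewrite [RHS]mxE => <-.
by rewrite dotpE -row_facet_mx !mxE; apply: eq_bigr => l _; rewrite !mxE.
Qed.

End Fan.

(** * The fan over the boundary *)

(** Turns the cardinals of finite sets of faces or of lattice points into those of
finite combinatorial models. *)
Lemma card_fset_set_image (T : choiceType) (I : finType) (A : {set I}) (f : I -> T)
    (S : set T) : {in A &, injective f} -> S = f @` [set` A] ->
  #|` fset_set S| = #|A|.
Proof.
move=> fi ->; have fA : finite_set [set` A] by exact: finite_finpred.
have -> : fset_set (f @` [set` A]) = [fset f x | x in A]%fset.
  apply/fsetP => y; rewrite in_fset_set; last exact: finite_image.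
  apply/idP/imfsetP => [/set_mem[x xA <-]|[x xA ->]]; first by exists x.
  by apply/mem_set; exists x.
by rewrite card_in_imfset//= cardE.
Qed.


Section Cones.
Variables (R : realType) (d : nat) (P : set 'rV[R]_d) (D : dual_pair P).
Hypotheses (P0 : P° 0) (hsimp : simplicial P).

Local Notation n := (nv D).
Local Notation q := (nf D).
Local Notation U := (map_mx intr (vert D) : 'M[R]_(n, d)).
Local Notation W := (map_mx intr (normal D) : 'M[R]_(q, d)).
Local Notation cvert := (corner_vert P0 hsimp).
Local Notation vmx := (@facet_mx R d P D P0 hsimp).
Implicit Types (j : 'I_q) (k : 'I_n).

Definition supported (S : {set 'I_n}) (c : 'rV[R]_n) := forall k, k \notin S -> c 0 k = 0.

Definition nonneg (c : 'rV[R]_n) := forall k, 0 <= c 0 k.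

Lemma supported_sum S c (f : 'I_n -> R) : supported S c ->
  \sum_k c 0 k * f k = \sum_(k in S) c 0 k * f k.
Proof.
move=> cS; rewrite [LHS](bigID (fun k => k \in S))/= [X in _ + X]big1 ?addr0//.
by move=> k /cS ->; rewrite mul0r.
Qed.

Lemma supported_height j c : supported (tight j) c ->
  dotp (row j W) (c *m U) = \sum_k c 0 k.
Proof.
move=> cT; rewrite dotp_mulmxr (supported_sum _ cT).
transitivity (\sum_k c 0 k * 1); last by apply: eq_bigr => k _; rewrite mulr1.
rewrite (supported_sum (fun=> 1) cT).
by apply: eq_bigr => k /tightP ->.
Qed.

Definition spread j (y : 'rV[R]_d) : 'rV[R]_n := scatter (cvert j) y.

Lemma spread_cvert j y i : spread j y 0 (cvert j i) = y 0 i.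
Proof. by apply: scatter_at; exact: corner_vert_inj. Qed.

Lemma spread_supported j y : supported (tight j) (spread j y).
Proof.
move=> k kT; apply: scatter_out => i; apply: contraNneq kT => ->.
exact: corner_vert_tight.
Qed.

Lemma spread_nonneg j (y : 'rV[R]_d) : (forall i, 0 <= y 0 i) -> nonneg (spread j y).
Proof. by move=> y0 k; rewrite scatterE sumr_ge0// => i _; rewrite mulr_ge0. Qed.

Lemma spread_mul j y : spread j y *m U = y *m vmx j.
Proof.
rewrite scatter_mul; congr (_ *m _).
by apply/row_matrixP => i; rewrite row_rowsub row_facet_mx.
Qed.

Lemma spreadK j c : supported (tight j) c ->
  c = spread j (\row_i c 0 (cvert j i)).
Proof.
move=> cT; apply/rowP => k; have [kT|kT] := boolP (k \in tight j).
  by have [i ->] := corner_vertP P0 hsimp kT; rewrite spread_cvert mxE.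
by rewrite cT// spread_supported.
Qed.

Lemma spread_sum j y : \sum_k spread j y 0 k = \sum_i y 0 i.
Proof. exact: scatter_sum. Qed.

(** The dual contains 0, so it has a generator. *)
Lemma nf_gt0 : (0 < q)%N.
Proof.
have : dual P 0 by move=> v _; rewrite dotp0l ler01.
move=> /(dual_normal D)[c [_ c1] _]; rewrite lt0n; apply/eqP => q0; move/eqP: c1.
rewrite big1 => [|i _]; first by rewrite eq_sym oner_eq0.
by have := ltn_ord i; rewrite [X in (_ < X)%N]q0.
Qed.

(** Take a normal w_j with the largest <w_j, x> and write x in the basis of
vertices of facet j.  If the coefficient of vertex i were negative, let z be
orthogonal to the other vertices of the facet with <z, vertex i> = -1.  Then
w_j + e z is still in the dual for a small e > 0, and it gives x a larger value:
this is a pivot of the simplex method. *)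
Lemma cone_cover x : exists j c, [/\ supported (tight j) c, nonneg c & x = c *m U].
Proof.
pose j0 : 'I_q := Ordinal nf_gt0.
pose j := [arg max_(j > j0) dotp (row j W) x]%O.
have jmax i : dotp (row i W) x <= dotp (row j W) x.
  by rewrite /j; case: arg_maxP => //= i' _ h; exact: h.
pose y := x *m invmx (vmx j).
have xE : x = y *m vmx j by rewrite mulmxKV// facet_mx_unit.
exists j, (spread j y); split; [exact: spread_supported| |by rewrite spread_mul].
apply: spread_nonneg => i; rewrite leNgt; apply/negP => yi.
pose z : 'rV[R]_d := - (invmx (vmx j) *m delta_mx i (0 : 'I_1))^T.
have zV l : dotp z (row l (vmx j)) = - (l == i)%:R.
  rewrite dotpC dotpE /z linearN /= trmxK mulmxN mulmxA mxE -row_mul.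
  rewrite mulmxV ?facet_mx_unit// -row_mul mul1mx !mxE eqxx andbT.
  by rewrite ?mulr1n.
have zx : 0 < dotp z x.
  rewrite xE dotp_mulmxr (bigD1 i)//= zV eqxx big1; last first.
    by move=> l li; rewrite zV (negPf li) oppr0 mulr0.
  by rewrite addr0 mulrN1 oppr_gt0.
have [e e0 he] := small_step (fun k => dotp (row j W) (row k U)) (fun k => dotp z (row k U)).
have /(dual_normal D)[c cc cE] : dual P (row j W + e *: z).
  apply/(dualP D) => k; rewrite dotpDl dotpZl.
  have [kT|kT] := boolP (k \in tight j); last exact/ltW/he/not_tight.
  have /tightP -> := kT; have [l ->] := corner_vertP P0 hsimp kT.
  rewrite -row_facet_mx zV gerDl mulrN oppr_le0 mulr_ge0 ?ler0n// ltW //.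
have : dotp (c *m W) x <= dotp (row j W) x.
  rewrite dotp_mulmxl.
  exact: (convex_coef_le (f := fun i => dotp (row i W) x)).
rewrite -cE dotpDl dotpZl gerDl pmulr_rle0// => /(lt_le_trans zx).
by rewrite ltxx.
Qed.

Lemma height_le j c : nonneg c -> dotp (row j W) (c *m U) <= \sum_k c 0 k.
Proof.
move=> c0; rewrite dotp_mulmxr; apply: ler_sum => k _.
by rewrite ler_piMr// pairing_le1.
Qed.

(** A normal is at most 1 on the vertices, with equality exactly on its facet.
Evaluating w_j and w_j' at the common point bounds each sum of coefficients by
the other; the equality then forces the vertices with a positive coefficient in
c to lie on facet j' too, and the vertices of facet j' are independent. *)
Lemma cone_unique j j' c c' : nonneg c -> nonneg c' ->
  supported (tight j) c -> supported (tight j') c' -> c *m U = c' *m U -> c = c'.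
Proof.
move=> c0 c0' cT cT' E.
have s1 : \sum_k c' 0 k <= \sum_k c 0 k.
  by rewrite -(supported_height cT') -E height_le.
have s2 : \sum_k c 0 k <= \sum_k c' 0 k.
  by rewrite -(supported_height cT) E height_le.
have s : \sum_k c 0 k * (1 - dotp (row j' W) (row k U)) = 0.
  under eq_bigr do rewrite mulrBr mulr1.
  rewrite sumrB -dotp_mulmxr E supported_height//; apply/eqP.
  by rewrite subr_eq0 eq_le s1 s2.
have cT2 : supported (tight j') c.
  move=> k kT; move/eqP: s; rewrite psumr_eq0; last first.
    by move=> l _; rewrite mulr_ge0// subr_ge0 pairing_le1.
  move=> /allP/(_ k); rewrite mem_index_enum => /(_ isT).
  by rewrite mulf_eq0 subr_eq0 (gt_eqF (not_tight kT)) orbF => /eqP.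
apply/eqP; rewrite -subr_eq0; apply/eqP; apply: (tight_free P0 hsimp (j := j')).
  by move=> k kT; rewrite !mxE cT2// cT'// subrr.
by rewrite mulmxBl E subrr.
Qed.

(** In particular membership in P is decided on the cone of any facet by the sum of
the coefficients.  The slack 1 - sum is put on the origin, which belongs to P. *)
Lemma cone_in_dilate (m : nat) j c : nonneg c -> supported (tight j) c ->
  [set m%:R *: x | x in P] (c *m U) <-> \sum_k c 0 k <= m%:R.
Proof.
move=> c0 cT; split=> [[x Px xE]|cm].
  rewrite -(supported_height cT) -xE dotpZr ler_piMr ?ler0n//.
  exact: (@dual_row _ _ _ D j x Px).
have [m0|m0] := eqVneq m 0%N.
  exists 0; first exact: polytope0.
  suff -> : c = 0 by rewrite mul0mx scaler0.
  have : \sum_k c 0 k == 0.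
    by rewrite eq_le; apply/andP; split; [rewrite m0 in cm|exact: sumr_ge0].
  rewrite psumr_eq0// => /allP h; apply/rowP => k; rewrite mxE.
  by have := h k; rewrite mem_index_enum => /(_ isT)/eqP.
have mp : (0 : R) < m%:R by rewrite ltr0n lt0n.
exists (m%:R^-1 *: (c *m U)); last by rewrite scalerA divff ?gt_eqF// scale1r.
have /(polytopeP D)[a [a0 a1] aE] := polytope0 P0.
pose s := m%:R^-1 * \sum_k c 0 k.
have s1 : s <= 1 by rewrite /s mulrC ler_pdivrMr// mul1r.
apply/(polytopeP D); exists (m%:R^-1 *: c + (1 - s) *: a).
  split=> [k|].
    by rewrite !mxE addr_ge0// mulr_ge0 ?invr_ge0 ?(ltW mp) ?subr_ge0.
  under eq_bigr do rewrite !mxE.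
  by rewrite big_split /= -!mulr_sumr a1 mulr1 -/s addrC subrK.
by rewrite mulmxDl -!scalemxAl -aE scaler0 addr0.
Qed.

End Cones.

(** * Faces *)

Section Faces.
Variables (R : realType) (d : nat) (P : set 'rV[R]_d) (D : dual_pair P).
Hypotheses (P0 : P° 0) (hsimp : simplicial P) (hdim : has_dim P d).

Local Notation n := (nv D).
Local Notation q := (nf D).
Local Notation U := (map_mx intr (vert D) : 'M[R]_(n, d)).
Local Notation W := (map_mx intr (normal D) : 'M[R]_(q, d)).
Local Notation vmx := (@facet_mx R d P D P0 hsimp).
Implicit Types (j : 'I_q) (k : 'I_n) (S : {set 'I_n}).

Definition conv_face S : set 'rV[R]_d :=
  [set x | exists c, [/\ convex_coef c, supported S c & x = c *m U]].

Lemma conv_face_vert S k : k \in S -> conv_face S (row k U).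
Proof.
move=> kS; exists (delta_mx 0 k); split; [exact: convex_coef_delta| |by rewrite -rowE].
move=> l lS; rewrite mxE; case: (eqVneq l k) => // lk.
by rewrite lk kS in lS.
Qed.

Lemma conv_face_inj : injective conv_face.
Proof.
suff H S S' : conv_face S = conv_face S' -> S \subset S'.
  by move=> S S' E; apply/eqP; rewrite finset.eqEsubset !H.
move=> E; apply/fintype.subsetP => k /conv_face_vert; rewrite E => -[c [cc cS cE]].
have cd : c = delta_mx 0 k by apply: (@vert_irr _ _ _ D).
apply: contraT => /cS; rewrite cd mxE !eqxx /= => /eqP.
by rewrite oner_eq0.
Qed.

Definition level (a : 'rV[R]_d) b : {set 'I_n} := [set k | dotp a (row k U) == b]%SET.

Lemma face_conv a b : (forall k, dotp a (row k U) <= b) ->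
  [set x | P x /\ dotp a x = b] = conv_face (level a b).
Proof.
move=> ab; apply/seteqP; split=> x /=.
  move=> [/(polytopeP D)[c cc xE] ax]; exists c; split => // k.
  apply: contraNeq => ck; rewrite inE; apply/eqP.
  apply: (convex_coef_pos (f := fun k => dotp a (row k U)) cc ab).
    by rewrite -dotp_mulmxr -xE.
  by rewrite lt_neqAle eq_sym ck cc.1.
move=> [c [cc cS xE]]; split; first by apply/(polytopeP D); exists c.
rewrite xE dotp_mulmxr; transitivity ((\sum_k c 0 k) * b); last by rewrite cc.2 mul1r.
rewrite mulr_suml.
apply: eq_bigr => k _; have [|kS] := boolP (k \in level a b); last by rewrite (cS _ kS) !mul0r.
by rewrite inE => /eqP ->.
Qed.

Lemma facet_of_conv j : facet_of j = conv_face (tight j).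
Proof. exact: (face_conv (@pairing_le1 _ _ _ D j)). Qed.

(** Tilt the normal w_j by a small multiple of a functional which vanishes on the
vertices of S and is 1 on the other vertices of facet j. *)
Lemma conv_face_is_face j S : S \subset tight j -> face P (conv_face S).
Proof.
move=> ST.
pose v : 'cV[R]_d := \col_i (corner_vert P0 hsimp j i \notin S)%:R.
pose z : 'rV[R]_d := (invmx (vmx j) *m v)^T.
have zV k : k \in tight j -> dotp z (row k U) = (k \notin S)%:R.
  move=> /(corner_vertP P0 hsimp)[i ->].
  rewrite -row_facet_mx dotpC dotpE /z trmxK mulmxA -row_mul mulmxV ?facet_mx_unit//.
  by rewrite -row_mul mul1mx !mxE.
have [e e0 he] := small_step (fun k => dotp (row j W) (row k U)) (fun k => - dotp z (row k U)).
pose a := row j W - e *: z.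
have aE k : dotp a (row k U) = dotp (row j W) (row k U) + e * - dotp z (row k U).
  by rewrite /a -scaleNr dotpDl dotpZl mulrN mulNr.
have a1 k : dotp a (row k U) <= 1.
  rewrite aE; have [kT|kT] := boolP (k \in tight j); last exact/ltW/he/not_tight.
  have /tightP -> := kT; rewrite zV// gerDl mulrN oppr_le0.
  by rewrite mulr_ge0 ?ler0n// ltW.
exists a, 1; split=> [x /(polytopeP D)[c cc ->]|].
  by rewrite dotp_mulmxr; exact: (convex_coef_le (f := fun k => dotp a (row k U))).
rewrite (face_conv a1); congr conv_face; apply/setP => k; rewrite inE.
have [kT|kT] := boolP (k \in tight j); last first.
  rewrite aE lt_eqF ?he ?not_tight//; apply/negbTE.
  by apply: contra kT; exact: (fintype.subsetP ST).
rewrite aE zV//; have /tightP -> := kT.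
case: (k \in S) => /=; first by rewrite oppr0 mulr0 addr0 eqxx.
by apply/esym/negbTE; rewrite lt_eqF// mulrN1 ltrBlDr ltrDl.
Qed.

Lemma widen_ord_inj m m' (h : (m <= m')%N) : injective (widen_ord h).
Proof. by move=> i i' /(congr1 val) /= /val_inj. Qed.

Lemma has_aff_indepW (A : set 'rV[R]_d) m m' : (m' <= m)%N ->
  has_aff_indep A m -> has_aff_indep A m'.
Proof.
move=> mm' [V [VA Vi]]; have w_inj := widen_ord_inj (h := mm').
exists (rowsub (widen_ord mm') V); split=> [i|c c1 cV].
  by rewrite row_rowsub; exact: VA.
by apply: (scatter_eq0 w_inj); apply: Vi; rewrite ?scatter_sum ?scatter_mul.
Qed.

(** In the hyperplane of facet j, which misses the origin, affine and linear
independence coincide, and the vertices in S span a subspace of dimension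
#|S|. *)
Lemma conv_face_aff_indep j S m : S \subset tight j ->
  has_aff_indep (conv_face S) m <-> (m <= #|S|)%N.
Proof.
move=> ST; pose s (i : 'I_#|S|) := enum_val i; pose M := rowsub s U.
have rowM i : row i M = row (s i) U by rewrite row_rowsub.
split=> [[V [VS Vi]]|mS].
  have /choice[a aP] : forall i, exists a : 'rV[R]_#|S|, row i V = a *m M.
    move=> i; have [c [cc cS cV]] := VS i; exists (\row_i c 0 (s i)); rewrite cV.
    rewrite !mulmx_sum_row [LHS](bigID (fun k => k \in S))/= [X in _ + X]big1 ?addr0.
      by rewrite big_enum_val /=; apply: eq_bigr => l _; rewrite mxE rowM.
    by move=> k /cS ->; rewrite scale0r.
  have VM : V = (\matrix_i a i) *m M.
    by apply/row_matrixP => i; rewrite row_mul rowK aP.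
  have fV : row_free V.
    apply: row_free_inj => c cV; apply: Vi => //.
    have := congr1 (dotp (row j W)) cV; rewrite dotp0r dotp_mulmxr => h.
    rewrite -[RHS]h; apply: eq_bigr => i _; have [b [bb bS ->]] := VS i.
    rewrite supported_height; first by rewrite bb.2 mulr1.
    by move=> k kT; apply: bS; apply: contra kT; exact: (fintype.subsetP ST).
  move: fV; rewrite /row_free => /eqP <-; rewrite VM.
  by apply: leq_trans (mxrankM_maxr _ _) _; exact: rank_leq_row.
apply: (has_aff_indepW mS); exists M; split.
  by move=> i; rewrite rowM; exact/conv_face_vert/enum_valP.
move=> c _ cM.
apply: (scatter_eq0 enum_val_inj); apply: (tight_free P0 hsimp (j := j)).
  move=> k kT; apply: scatter_out => i; apply: contraNneq kT => ->.
  by rewrite (fintype.subsetP ST)// enum_valP.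
by rewrite scatter_mul.
Qed.

Lemma conv_face_dim j S i : S \subset tight j ->
  has_dim (conv_face S) i <-> #|S| = i.+1.
Proof.
move=> ST; rewrite /has_dim !(conv_face_aff_indep _ ST).
split=> [[h /negP]|->]; last by split => //; rewrite ltnn.
by rewrite -leqNgt => h'; apply/eqP; rewrite eqn_leq h h'.
Qed.

Lemma has_dim_neq G i : (i < d)%N -> has_dim G i -> G <> P.
Proof.
move=> id [_ Gi] GP; apply: Gi; rewrite GP.
by apply: has_aff_indepW hdim.1; rewrite ltnS.
Qed.

(** Let g be the barycenter of the vertices on G and let facet j have g in its cone.
The functional defining G, normalized to be at most 1 on P, shows that the
coefficients of g add up to 1, so g lies on facet j; then so do all the vertices
of which g is an average. *)
Lemma proper_face G x : face P G -> G x -> G <> P ->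
  exists j S, S \subset tight j /\ G = conv_face S.
Proof.
move=> [a [b [ab GE]]] Gx GP.
have abk k : dotp a (row k U) <= b by apply: ab; exact: polytope_vert.
have b0 : 0 < b.
  have [a0|a0] := eqVneq a 0; last exact: (supporting_gt0 P0 a0 ab).
  exfalso; apply: GP; rewrite GE; apply/seteqP; split=> [y []//|y Py] /=.
  split=> //; move: Gx; rewrite GE => -[_ <-].
  by rewrite a0 !dotp0l.
pose S := level a b.
have GS : G = conv_face S by rewrite GE (face_conv abk).
have S0 : (0 < #|S|)%N.
  rewrite card_gt0; apply/set0Pn; move: Gx; rewrite GS => -[c [cc cS _]].
  apply/existsP; apply: contraT; rewrite negb_exists => /forallP S0.
  move/eqP: cc.2; rewrite big1 => [|k _]; last exact/cS/S0.
  by rewrite eq_sym oner_eq0.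
have sp : (0 : R) < #|S|%:R by rewrite ltr0n.
pose g0 : 'rV[R]_n := \row_k ((k \in S)%:R / #|S|%:R).
have cg : convex_coef g0.
  split=> [k|]; first by rewrite mxE divr_ge0.
  under eq_bigr do rewrite mxE.
  rewrite -mulr_suml (_ : \sum_k _ = #|S|%:R) ?divff ?gt_eqF//.
  rewrite -sum1_card natr_sum [RHS]big_mkcond; apply: eq_bigr => k _.
  by case: (k \in S).
have Gg : G (g0 *m U).
  rewrite GS; exists g0; split => // k kS.
  by rewrite mxE (negPf kS) mul0r.
have [j [c [cT c0 gE]]] := cone_cover D P0 hsimp (g0 *m U).
have [Pg ag] : [set x | P x /\ dotp a x = b] (g0 *m U) by rewrite -GE.
have wg : dotp (row j W) (g0 *m U) = 1.
  apply/eqP; rewrite eq_le; apply/andP; split; first exact: (@dual_row _ _ _ D j _ Pg).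
  rewrite gE supported_height// -(ler_pM2r b0) mul1r.
  rewrite -{1}ag gE dotp_mulmxr mulr_suml; apply: ler_sum => k _.
  exact: ler_wpM2l.
exists j, S; split => //; apply/fintype.subsetP => k kS; apply/tightP.
apply: (convex_coef_pos (f := fun k => dotp (row j W) (row k U)) cg).
- by move=> i; exact: pairing_le1.
- by rewrite -dotp_mulmxr.
- by rewrite mxE kS divr_gt0.
Qed.

(** Indexed by the number of vertices, one more than the dimension, so that i = 0
gives the empty simplex. *)
Definition simplices i : {set {set 'I_n}} :=
  [set S : {set 'I_n} | (#|S| == i) && [exists j, S \subset tight j]]%SET.

Lemma f_vectorE i : (i < d)%N -> f_vector P i = #|simplices i.+1|.
Proof.
move=> id; rewrite /f_vector (@card_fset_set_image _ _ (simplices i.+1) conv_face)//.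
  by move=> S S' _ _; exact: conv_face_inj.
apply/seteqP; split=> [G [PG Gi]|_ [S + <-]] /=.
  have [[V [VG _]] _] := Gi.
  have [j [S [ST GS]]] := proper_face PG (VG 0) (has_dim_neq id Gi).
  exists S => //; rewrite inE; apply/andP; split.
    by apply/eqP/(conv_face_dim _ ST); rewrite -GS.
  by apply/existsP; exists j.
rewrite /= inE => /andP[/eqP Si /existsP[j ST]]; split.
  exact: (conv_face_is_face ST).
exact/(conv_face_dim _ ST).
Qed.

Hypothesis hd : (0 < d)%N.

Lemma facet_of_facet j : facet P (facet_of j).
Proof.
split; first exact: facet_of_face.
by rewrite facet_of_conv; apply/(conv_face_dim _ (subxx (tight j))); rewrite card_tight// prednK.
Qed.

Lemma facetP F : facet P F <-> exists j, F = facet_of j.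
Proof.
split=> [[PF Fd]|[j ->]]; last exact: facet_of_facet.
have [[V [VF _]] _] := Fd.
have d1 : (d.-1 < d)%N by rewrite prednK.
have [j [S [ST FS]]] := proper_face PF (VF 0) (has_dim_neq d1 Fd).
exists j; rewrite facet_of_conv FS; congr conv_face; apply/eqP.
rewrite eqEcard ST (card_tight P0 hsimp).
by move: Fd; rewrite FS => /(conv_face_dim _ ST) ->; rewrite prednK//= leqnn.
Qed.

Lemma facet_of_inj : injective (@facet_of R d P D).
Proof.
move=> j j'; rewrite !facet_of_conv => /conv_face_inj T.
have E : row j W = row j' W.
  apply/eqP; rewrite -subr_eq0; apply/eqP; apply: (@tight_spanning _ _ _ D j) => k kT.
  rewrite dotpDl -scaleN1r dotpZl; have /tightP -> := kT.
  by move: kT; rewrite T => /tightP ->; rewrite mulN1r subrr.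
have : delta_mx 0 j = delta_mx 0 j' :> 'rV[R]_q.
  apply: (@normal_irr _ _ _ D); first exact: convex_coef_delta.
  by rewrite -rowE.
move=> /rowP/(_ j); rewrite !mxE !eqxx /=; case: eqP => //= _ /eqP.
by rewrite oner_eq0.
Qed.

(** The coordinate of index i in the basis of vertices of the facet is at most 1 on
the facet, with equality at vertex i only. *)
Lemma vertex_facet_of j : vertex (facet_of j) = range (fun i => row i (vmx j)).
Proof.
apply/seteqP; split=> [v [a [b [ab vE]]]|_ [i _ <-]].
  have [] : [set x | facet_of j x /\ dotp a x = b] v by rewrite -vE.
  rewrite facet_of_conv => -[c [cc cT cE]] av.
  have [k ck] : exists k, 0 < c 0 k.
    apply/existsP; apply: contraT; rewrite negb_exists => /forallP c0.
    move/eqP: cc.2; rewrite big1 ?(eq_sym 0) ?oner_eq0// => k _.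
    by apply/eqP; rewrite eq_le cc.1 andbT leNgt.
  have kT : k \in tight j.
    by apply: contraLR ck => /cT ->; rewrite ltxx.
  have kF l : l \in tight j -> facet_of j (row l U) by exact: facet_of_vert.
  have ak : dotp a (row k U) = b.
    pose f l := if l \in tight j then dotp a (row l U) else b.
    rewrite -[LHS](_ : f k = _); last by rewrite /f kT.
    apply: (convex_coef_pos (f := f) cc) ck => [l|].
      by rewrite /f; case: ifP => // /kF/ab.
    rewrite -[RHS]av cE dotp_mulmxr; apply: eq_bigr => l _; rewrite /f.
    by case: ifPn => // /cT ->; rewrite !mul0r.
  have [i ki] := corner_vertP P0 hsimp kT.
  exists i => //; rewrite row_facet_mx -ki.
  by have : [set v] (row k U) by rewrite vE; split; [exact: kF|].
pose z : 'rV[R]_d := (invmx (vmx j) *m delta_mx i (0 : 'I_1))^T.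
have zV l : dotp z (row l (vmx j)) = (l == i)%:R.
  rewrite dotpC dotpE /z trmxK mulmxA -row_mul mulmxV ?facet_mx_unit//.
  by rewrite -row_mul mul1mx !mxE eqxx andbT.
have F1 x : facet_of j x -> exists y : 'rV[R]_d, [/\ forall l, 0 <= y 0 l,
    \sum_l y 0 l = 1, x = y *m vmx j & dotp z x = y 0 i].
  rewrite facet_of_conv => -[c [cc cT ->]].
  have [y yE] : exists y, c = spread P0 hsimp j y.
    by exists (\row_l c 0 (corner_vert P0 hsimp j l)); exact: spreadK.
  have yc l : y 0 l = c 0 (corner_vert P0 hsimp j l) by rewrite yE spread_cvert.
  exists y; split.
  - by move=> l; rewrite yc cc.1.
  - by rewrite -(spread_sum P0 hsimp j) -yE cc.2.
  - by rewrite yE spread_mul.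
  - rewrite yE spread_mul dotp_mulmxr (bigD1 i)//= zV eqxx mulr1 big1 ?addr0//.
    by move=> l li; rewrite zV (negPf li) mulr0.
exists z, 1; split=> [x /F1[y [y0 y1 _ ->]]|].
  by rewrite -y1 (bigD1 i)//= lerDl sumr_ge0.
apply/seteqP; split=> [_ ->|x [/F1[y [y0 y1 -> ->]] yi]] /=.
  split; last by rewrite zV eqxx.
  by rewrite row_facet_mx; exact/facet_of_vert/corner_vert_tight.
have -> : y = delta_mx 0 i by apply: convex_coef_eq_delta.
by rewrite -rowE.
Qed.

End Faces.

(** * Lattice volume of a facet *)

Lemma det_int_unit n (C : 'M[int]_n) : C \in unitmx -> `|\det C | = 1.
Proof. by rewrite unitmxE qualifE /= => /orP[] /eqP ->. Qed.

Lemma delta_col_mx (T : pzRingType) m :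
  delta_mx 0 0 = col_mx 1%:M 0 :> 'cV[T]_(1 + m).
Proof.
apply/matrixP => i j; rewrite !ord1 [LHS]mxE eqxx andbT -val_eqE [RHS]mxE.
by case: splitP => k /= ->; rewrite mxE ?ord1.
Qed.

(** F is the simplex with integral vertices the rows of V, on the hyperplane
<w, x> = 1 with w integral. *)
Section Chart.
Variables (R : realType) (m : nat).
Variables (V : 'M[int]_m.+1) (w : 'rV[int]_m.+1) (F : set 'rV[R]_m.+1).
Local Notation "A ^R" := (map_mx intr A : 'M[R]_(_, _)) (at level 8, format "A ^R").
Hypothesis Vw : V *m w^T = const_mx 1.
Hypothesis V0 : \det V != 0.
Hypothesis FE : F = [set x | exists y : 'rV[R]_m.+1,
  [/\ forall i, 0 <= y 0 i, \sum_i y 0 i = 1 & x = y *m V^R]].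

Let VRu : V^R \in unitmx.
Proof. by rewrite unitmxE det_map_mx unitfE intr_eq0. Qed.

Let VwR : V^R *m w^R^T = const_mx 1.
Proof. by rewrite map_trmx -map_mxM Vw; apply/matrixP => i j; rewrite !mxE. Qed.

Let sumE (y : 'rV[R]_m.+1) : dotp w^R (y *m V^R) = \sum_i y 0 i.
Proof.
rewrite dotpC dotpE -mulmxA VwR mxE; apply: eq_bigr => i _.
by rewrite mxE mulr1.
Qed.

Let FV i : F (row i V^R).
Proof.
rewrite FE; exists (delta_mx 0 i); split; last by rewrite -rowE.
  by move=> j; rewrite mxE.
by have [] := @convex_coef_delta R _ i.
Qed.

Lemma aff_hull_facet : aff_hull F = [set x | dotp w^R x = 1].
Proof.
apply/seteqP; split=> [x [n [A [c [AF c1 ->]]]]|x /= wx].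
  rewrite /= dotp_mulmxr -[RHS]c1; apply: eq_bigr => i _.
  have := AF i; rewrite FE => -[y [_ y1 ->]].
  by rewrite sumE y1 mulr1.
have xE : x = (x *m invmx V^R) *m V^R by rewrite mulmxKV.
exists m.+1, V^R, (x *m invmx V^R); split => //.
by rewrite -sumE -xE.
Qed.

Local Notation L := (aff_hull F `&` @int_lattice R m.+1).

Lemma facet_latticeP x : L x <-> exists z : 'rV[int]_m.+1,
  x = z^R /\ z *m w^T = 1%:M.
Proof.
have E (z : 'rV[int]_m.+1) : dotp w^R z^R = ((z *m w^T) 0 0)%:~R.
  by rewrite dotpC dotpE map_trmx -map_mxM mxE.
rewrite aff_hull_facet; split=> [[/= wx [z _ zx]]|[z [-> zw]]].
  exists z; split => //; move: wx; rewrite -zx E => /eqP.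
  rewrite (_ : 1 = 1%:~R :> R)// eqr_int => /eqP h.
  by apply/matrixP => i j; rewrite !ord1 h mxE.
by split; [rewrite /= E zw mxE|exists z].
Qed.

(** A primitive integral functional is a coordinate in some basis of Z^(m+1): in the
Smith normal form of the column w the only invariant factor is invertible,
because w takes the value 1 at the vertices. *)
Lemma unimodular_height : exists2 C : 'M[int]_(1 + m), C \in unitmx &
  C *m w^T = delta_mx 0 0.
Proof.
have [K uK [r ur [s _ wE]]] := int_Smith_normal_form w^T.
pose g := s`_0 * r 0 0.
have Kw : invmx K *m w^T = g *: delta_mx 0 0.
  rewrite wE -mulmxA mulKmx//; apply/matrixP => i j.
  rewrite !mxE big_ord1 !mxE !ord1 eqxx andbT -val_eqE /= /g.
  by case: eqP => [->|_]; rewrite ?mulr0n ?mulr1n ?mul0r ?mulr0 ?mulr1.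
have g1 : (row 0 V *m K) 0 0 * g = 1.
  have : row 0 V *m K *m (invmx K *m w^T) = 1%:M.
    by rewrite mulmxA mulmxK// -row_mul Vw; apply/matrixP => i j; rewrite !ord1 !mxE.
  rewrite Kw -scalemxAr -colE => /matrixP/(_ 0 0).
  by rewrite mulrC [LHS]mxE [X in _ * X = _]mxE [RHS]mxE.
have ug : g \is a GRing.unit by apply/unitrP; exists ((row 0 V *m K) 0 0); rewrite g1 mulrC g1.
have gg : g * g = 1.
  by move: ug; rewrite qualifE /= => /orP[] /eqP ->.
(* g is 1 or -1; the factor g makes the height exactly 1 *)
exists (g *: invmx K); first by rewrite unitmxZ// unitmx_inv.
by rewrite -scalemxAl Kw scalerA gg scale1r.
Qed.

Lemma map_intr_inj p' q' : injective (fun A : 'M[int]_(p', q') => A^R).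
Proof.
move=> A B E; apply/matrixP => i j; have /matrixP/(_ i j) := E.
by rewrite !mxE => /intr_inj.
Qed.

(** The first row of a unimodular matrix adapted to w is an origin at height 1, and
the other rows form a basis of the lattice at height 0. *)
Lemma chart_exists : exists p (B : 'M[R]_(m, m.+1)), lattice_chart F p B.
Proof.
have [C uC Cw] := unimodular_height.
pose p := @usubmx _ 1 m m.+1 C; pose B := @dsubmx _ 1 m m.+1 C.
have CE : C = col_mx p B by rewrite vsubmxK.
have [pw Bw] : p *m w^T = 1%:M /\ B *m w^T = 0.
  have : col_mx (p *m w^T) (B *m w^T) = col_mx 1%:M 0 :> 'cV_(1 + m).
    by rewrite -mul_col_mx -CE Cw delta_col_mx.
  by move/eq_col_mx.
exists p^R, B^R; split; first by apply/facet_latticeP; exists p.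
split=> [i|z /facet_latticeP[t [tz tw]]].
  apply/facet_latticeP; exists (p + row i B).
  by rewrite -map_row -map_mxD mulmxDl pw -row_mul Bw row0 addr0.
pose z0 := t - p.
have zE : z = z0^R by rewrite map_mxB -tz addrC addKr.
pose a : 'rV_(1 + m) := z0 *m invmx C.
have z0E : z0 = a *m C by rewrite mulmxKV.
have a0 : lsubmx a = 0.
  have : a *m (C *m w^T) = 0 by rewrite mulmxA -z0E mulmxBl tw pw subrr.
  rewrite Cw -colE => /matrixP/(_ 0 0); rewrite [LHS]mxE [RHS]mxE => a00.
  apply/matrixP => i j; rewrite !ord1 [LHS]mxE [RHS]mxE.
  by rewrite -a00; congr (a _ _); apply/val_inj.
have z0B : z0 = rsubmx a *m B.
  by rewrite z0E -{1}(hsubmxK a) a0 CE mul_row_col mul0mx add0r.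
exists (rsubmx a); split=> [|c]; first by rewrite -map_mxM -z0B.
rewrite zE -map_mxM => /map_intr_inj zc.
have : row_mx 0 (rsubmx a) *m C = row_mx 0 c *m C.
  by rewrite CE !mul_row_col !mul0mx !add0r -z0B.
by move=> /(congr1 (mulmxr (invmx C))); rewrite /= !mulmxK// => /eq_row_mx[].
Qed.

(** Conversely, the origin and the basis of a chart together span Z^(m+1): subtract
from z its height times p, and expand the rest in B. *)
Lemma chart_unimodular p (B : 'M[R]_(m, m.+1)) : lattice_chart F p B ->
  exists C : 'M[int]_(1 + m), [/\ col_mx p B = C^R, C \in unitmx & C *m w^T = delta_mx 0 0].
Proof.
move=> [/facet_latticeP[p0 [pE pw]] [BL Bz]].
have /choice[t tP] : forall i, exists t : 'rV[int]_m.+1, row i B = t^R /\ t *m w^T = 0.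
  move=> i; have /facet_latticeP[t [tE tw]] := BL i.
  exists (t - p0); split; last by rewrite mulmxBl tw pw subrr.
  by rewrite map_mxB -tE pE addrC addKr.
pose B0 := \matrix_i t i.
have BE : B = B0^R.
  by apply/row_matrixP => i; rewrite -map_row rowK; have [] := tP i.
have Bw : B0 *m w^T = 0.
  by apply/row_matrixP => i; rewrite row_mul rowK row0; have [] := tP i.
pose C : 'M[int]_(1 + m) := col_mx p0 B0.
have Cw : C *m w^T = delta_mx 0 0.
  by rewrite mul_col_mx pw Bw delta_col_mx.
have /choice[a aP] : forall z : 'rV[int]_m.+1, exists a, z = a *m C.
  move=> z; pose h := (z *m w^T) 0 0.
  have hE : z *m w^T = h%:M by apply/matrixP => i j; rewrite !ord1 [RHS]mxE eqxx.
  have [|c [cz _]] := Bz (z - h *: p0)^R.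
    apply/facet_latticeP; exists (p0 + (z - h *: p0)).
    split; first by rewrite [RHS]map_mxD -pE.
    by rewrite mulmxDl mulmxBl -scalemxAl pw hE scalemx1 subrr addr0.
  exists (row_mx h%:M c); rewrite mul_row_col mul_scalar_mx.
  have : z - h *: p0 = c *m B0.
    by apply: map_intr_inj; rewrite map_mxM -BE.
  by move=> <-; rewrite addrC subrK.
exists C; split => //; first by rewrite map_col_mx -pE -BE.
have : (\matrix_i a (row i 1%:M)) *m C = 1%:M.
  by apply/row_matrixP => i; rewrite row_mul rowK -aP.
by move/mulmx1_unit => [].
Qed.

(** In barycentric coordinates the facet is the standard simplex.  The matrix Q takes
(1, x) to the barycentric coordinates of p + x B, so that x |-> x M + b gives all
of them but the first, which is determined by the others.  Adding the other
columns of Q to the first one shows that M and Q have the same determinant,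
namely 1 / det V up to sign. *)
Lemma chart_volume p (B : 'M[R]_(m, m.+1)) : lattice_chart F p B ->
  vol [set x : 'rV[R]_m | F (p + x *m B)] = (`|\det V^R | / m`!%:R)%:E.
Proof.
move=> /chart_unimodular[C [CE uC Cw]].
have CEx (x : 'rV[R]_m) : p + x *m B = row_mx 1%:M x *m C^R.
  by rewrite -CE mul_row_col mul1mx.
pose Q : 'M[R]_(1 + m) := C^R *m invmx V^R.
have Q1 : Q *m const_mx 1 = delta_mx 0 0 :> 'cV_(1 + m).
  rewrite /Q -VwR -mulmxA mulKmx// map_trmx -map_mxM Cw.
  by apply/matrixP => i j; rewrite !mxE; case: (_ && _).
have detQ : `|\det Q| = `|\det V^R|^-1.
  rewrite /Q det_mulmx normrM det_inv normfV -[RHS]mul1r; congr (_ * _).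
  by rewrite det_map_mx -intr_norm (det_int_unit uC).
pose M := drsubmx Q; pose b := ursubmx Q.
have detM : \det M = \det Q.
  pose E : 'M[R]_(1 + m) := block_mx 1%:M 0 (const_mx 1) 1%:M.
  have QE : Q *m E = block_mx 1%:M b 0 M.
    rewrite -[Q in LHS]submxK mulmx_block !mulmx0 !mulmx1 !add0r.
    move: Q1; rewrite -[const_mx 1](@col_mx_const _ 1 m 1) -[Q in LHS]submxK.
    rewrite mul_block_col delta_col_mx => /eq_col_mx[].
    by rewrite (_ : const_mx 1 = 1%:M :> 'M[R]_1) ?mulmx1 => [-> ->|]; [|
      apply/matrixP => i j; rewrite !ord1 !mxE].
  have : \det (Q *m E) = \det M by rewrite QE det_ublock det1 mul1r.
  by rewrite det_mulmx det_lblock !det1 !mulr1 => ->.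
have uM : M \in unitmx.
  by rewrite unitmxE detM unitfE -normr_eq0 detQ invr_eq0 normr_eq0 -unitfE -unitmxE.
have <- : vol [set x : 'rV[R]_m | corner_simplex true 1 (x *m M + b)] =
    (`|\det V^R | / m`!%:R)%:E.
  rewrite vol_affine//; last exact: measurable_corner_simplex.
  by rewrite vol_corner_simplex// expr1n mul1r detM detQ invrK -EFinM.
congr vol; apply/funext => x /=; rewrite CEx.
pose y : 'rV[R]_(1 + m) := row_mx 1%:M x *m Q.
have yV : row_mx 1%:M x *m C^R = y *m V^R by rewrite /y /Q -mulmxA mulmxKV.
have yr : x *m M + b = rsubmx y.
  by rewrite /y -[Q]submxK mul_row_block row_mxKr mul1mx addrC.
have y1 : y 0 (lshift m 0) + \sum_i (x *m M + b) 0 i = 1.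
  have : y *m const_mx 1 = 1%:M :> 'M[R]_1.
    by rewrite /y -mulmxA Q1 delta_col_mx mul_row_col mulmx0 mulmx1 addr0.
  move=> /matrixP/(_ 0 0); rewrite [RHS]mxE eqxx mulr1n mxE big_split_ord big_ord1 /= => h.
  rewrite -[RHS]h yr; congr (_ + _); first by rewrite [X in _ * X]mxE mulr1.
  by apply: eq_bigr => i _; rewrite [X in _ * X]mxE mulr1 [LHS]mxE.
rewrite yV FE; apply/propext; split=> [[y' [y'0 _ yE]]|[y0 ys]].
  have yy : y = y'.
    by move: yE => /(congr1 (mulmxr (invmx V^R))); rewrite /= !mulmxK.
  split=> [i|]; first by rewrite yr mxE /= yy y'0.
  by rewrite -[leRHS]y1 lerDr yy y'0.
exists y; split => // [i|].
  case: (splitP (i : 'I_(1 + m))) => k ki.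
    have -> : i = lshift m (0 : 'I_1) by apply/val_inj; rewrite /= ki ord1.
    by rewrite -(lerD2r (\sum_i (x *m M + b) 0 i)) y1 add0r.
  have -> : i = rshift 1 k by exact: val_inj.
  by have := y0 k; rewrite yr mxE.
have := @big_split_ord R 0 +%R 1 m xpredT (fun i => y 0 i).
rewrite /= big_ord1 => E; rewrite [LHS]E -[RHS]y1; congr (_ + _).
by apply: eq_bigr => i _; rewrite yr [RHS]mxE.
Qed.

Theorem normalized_vol_simplex : normalized_vol m F = (`|\det V^R | / m`!%:R)%:E.
Proof.
rewrite /normalized_vol; case: xgetP => [_ -> [p [B [pB ->]]]|none].
  exact: chart_volume.
have [p [B pB]] := chart_exists.
by case: (none (vol [set x : 'rV[R]_m | F (p + x *m B)])); exists p, B.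
Qed.

End Chart.

(** * Volume and boundary volume *)

Lemma bigsetU_seqP (T : Type) (I : eqType) (s : seq I) (A : I -> set T) x :
  (\big[setU/set0]_(i <- s) A i) x <-> exists2 i, i \in s & A i x.
Proof.
elim: s => [|i s IH]; first by rewrite big_nil; split=> // -[].
rewrite big_cons; split=> [[Ai|/IH[j js Aj]]|[j]].
- by exists i => //; rewrite inE eqxx.
- by exists j => //; rewrite inE js orbT.
- by rewrite inE => /predU1P[-> Ai|js Aj]; [left|right; apply/IH; exists j].
Qed.

Section FiniteUnions.
Context d (T : measurableType d) (R : realType) (mu : {measure set T -> \bar R}).
Variables (I : eqType) (A : I -> set T).
Hypothesis mA : forall i, measurable (A i).

Lemma measure_bigsetU_le (s : seq I) :
  (mu (\big[setU/set0]_(i <- s) A i) <= \sum_(i <- s) mu (A i))%E.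
Proof.
elim: s => [|i s IH]; first by rewrite !big_nil measure0.
rewrite !big_cons; apply: le_trans (measureU2 _ _ _) _ => //.
  by apply: bigsetU_measurable.
by apply: leeD.
Qed.

Lemma measure_bigsetU_disjoint (s : seq I) : uniq s ->
  (forall i j, i != j -> A i `&` A j = set0) ->
  mu (\big[setU/set0]_(i <- s) A i) = (\sum_(i <- s) mu (A i))%E.
Proof.
move=> us dA; elim: s us => [|i s IH]/=; first by rewrite !big_nil measure0.
move=> /andP[si us]; rewrite !big_cons measureU//.
- by congr (_ + _)%E; exact: IH.
- by apply: bigsetU_measurable.
- rewrite -subset0 => x [Ai /bigsetU_seqP[j js Aj]].
  have ij : i != j by apply: contraNneq si => ->.
  by have : (A i `&` A j) x; [split|rewrite dA].
Qed.

End FiniteUnions.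

(** For a dimension d which is only known to be positive. *)
Lemma normalized_vol_simplex_pred (R : realType) d (V : 'M[int]_d) (w : 'rV[int]_d)
    (F : set 'rV[R]_d) : (0 < d)%N -> V *m w^T = const_mx 1 -> \det V != 0 ->
  F = [set x | exists y : 'rV[R]_d,
    [/\ forall i, 0 <= y 0 i, \sum_i y 0 i = 1 & x = y *m map_mx intr V]] ->
  normalized_vol d.-1 F = (`|\det (map_mx intr V : 'M[R]_d) | / (d.-1)`!%:R)%:E.
Proof. by case: d V w F => // m V w F _; exact: normalized_vol_simplex. Qed.

Section PolytopeVolume.
Variables (R : realType) (d : nat) (P : set 'rV[R]_d) (D : dual_pair P).
Hypotheses (P0 : P° 0) (hsimp : simplicial P) (hdim : has_dim P d) (hd : (0 < d)%N).

Local Notation n := (nv D).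
Local Notation q := (nf D).
Local Notation U := (map_mx intr (vert D) : 'M[R]_(n, d)).
Local Notation vmx := (@facet_mx R d P D P0 hsimp).
Implicit Types (j : 'I_q).

Definition facet_cone closed j : set 'rV[R]_d :=
  [set x | corner_simplex closed 1 (x *m invmx (vmx j))].

Lemma measurable_facet_cone closed j : measurable (facet_cone closed j).
Proof. by apply: measurable_linear; exact: measurable_corner_simplex. Qed.

Lemma vol_facet_cone closed j :
  vol (facet_cone closed j) = (`|\det (vmx j) | / d`!%:R)%:E.
Proof.
rewrite /facet_cone vol_linear ?unitmx_inv ?facet_mx_unit//; last exact: measurable_corner_simplex.
by rewrite vol_corner_simplex// expr1n mul1r det_inv normfV invrK -EFinM.
Qed.

Lemma facet_coneP closed j x : facet_cone closed j x -> exists c,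
  [/\ nonneg c, supported (tight j) c, x = c *m U, \sum_k c 0 k <= 1 &
    ~~ closed -> forall k, k \in tight j -> 0 < c 0 k].
Proof.
rewrite /facet_cone /=; set y := x *m _ => -[y0 y1].
have xE : x = y *m vmx j by rewrite mulmxKV ?facet_mx_unit.
exists (spread P0 hsimp j y); split.
- apply: spread_nonneg => i; have := y0 i; rewrite /Order.lteif.
  by case: ifP => // _; exact: ltW.
- exact: spread_supported.
- by rewrite spread_mul.
- by rewrite spread_sum.
- move=> /negPf cl k /(corner_vertP P0 hsimp)[i ->]; rewrite spread_cvert.
  by have := y0 i; rewrite cl.
Qed.

Lemma facet_cone_sub closed j : facet_cone closed j `<=` P.
Proof.
move=> x /facet_coneP[c [c0 cT -> c1 _]].
have [y Py] := (cone_in_dilate P0 1 c0 cT).2 c1.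
by rewrite scale1r => <-.
Qed.

Lemma polytope_cover : P = \big[setU/set0]_j facet_cone true j.
Proof.
apply/seteqP; split=> [x Px|x /bigsetU_seqP[j _]]; last exact: facet_cone_sub.
apply/bigsetU_seqP.
have [j [c [cT c0 xE]]] := cone_cover D P0 hsimp x.
exists j; first by rewrite mem_index_enum.
rewrite /facet_cone /= xE (spreadK P0 hsimp cT) spread_mul mulmxK ?facet_mx_unit//.
split=> [i|]; first by rewrite mxE /= c0.
rewrite -(spread_sum P0 hsimp j) -spreadK// -(supported_height cT) -xE.
exact: (@dual_row _ _ _ D j _ Px).
Qed.

Lemma open_cones_disjoint j j' : j != j' ->
  facet_cone false j `&` facet_cone false j' = set0.
Proof.
move=> jj'; rewrite -subset0 => x [].
move=> /facet_coneP[c [c0 cT xE _ /(_ isT) cp]] /facet_coneP[c' [c0' cT' xE' _ /(_ isT) cp']].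
have cc : c = c' by apply: (cone_unique P0 hsimp c0 c0' cT cT'); rewrite -xE -xE'.
move/eqP: jj'; apply; apply: (facet_of_inj (D := D)); rewrite !facet_of_conv.
congr conv_face; apply/setP => k; apply/idP/idP => kT.
  by apply: contraT => /cT' h; have := cp k kT; rewrite cc h ltxx.
by apply: contraT => /cT h; have := cp' k kT; rewrite -cc h ltxx.
Qed.

(** The closed simplices cover P, and those with positive coordinates are disjoint
subsets of P; the two families have the same volumes. *)
Theorem vol_polytope : vol P = ((\sum_j `|\det (vmx j) |) / d`!%:R)%:E.
Proof.
have sumE closed : (\sum_j volm R d (facet_cone closed j) =
    ((\sum_j `|\det (vmx j) |) / d`!%:R)%:E)%E.
  rewrite mulr_suml -sumEFin; apply: eq_bigr => j _.
  by rewrite -volE ?vol_facet_cone//; exact: measurable_facet_cone.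
have mP : measurable P.
  rewrite polytope_cover; apply: bigsetU_measurable => j _.
  exact: measurable_facet_cone.
apply/eqP; rewrite eq_le volE//; apply/andP; split.
  rewrite -(sumE true) {1}polytope_cover.
  by apply: measure_bigsetU_le => j; exact: measurable_facet_cone.
rewrite -(sumE false) -measure_bigsetU_disjoint ?index_enum_uniq//; last first.
- exact: open_cones_disjoint.
- by move=> j; exact: measurable_facet_cone.
apply: le_measure; rewrite ?inE//.
  by apply: bigsetU_measurable => j _; exact: measurable_facet_cone.
by move=> x /bigsetU_seqP[j _]; exact: facet_cone_sub.
Qed.

Lemma facet_of_simplex j : facet_of j = [set x | exists y : 'rV[R]_d,
  [/\ forall i, 0 <= y 0 i, \sum_i y 0 i = 1 & x = y *m vmx j]].
Proof.
rewrite facet_of_conv; apply/seteqP; split=> [x [c [cc cT ->]]|x [y [y0 y1 ->]]].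
  exists (\row_i c 0 (corner_vert P0 hsimp j i)); split.
  - by move=> i; rewrite mxE cc.1.
  - by rewrite -(spread_sum P0 hsimp j) -spreadK// cc.2.
  - by rewrite -spread_mul -spreadK.
exists (spread P0 hsimp j y); split.
- by split; [exact: spread_nonneg|rewrite spread_sum].
- exact: spread_supported.
- by rewrite spread_mul.
Qed.

Lemma normalized_vol_facet j :
  normalized_vol d.-1 (facet_of j) = (`|\det (vmx j) | / (d.-1)`!%:R)%:E.
Proof.
have Vw : facet_imx P0 hsimp j *m (row j (normal D))^T = const_mx 1.
  apply/matrixP => i l; rewrite ord1 [RHS]mxE; apply: (@intr_inj R).
  have := dotp_facet_mx P0 hsimp j i.
  rewrite dotpC dotpE /facet_mx -!map_row map_trmx -map_mxM -row_mul => h.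
  transitivity
    ((map_mx intr (row i (facet_imx P0 hsimp j *m (row j (normal D))^T)) : 'rV[R]_1) 0 0).
    by rewrite !mxE.
  exact: h.
have V0 : \det (facet_imx P0 hsimp j) != 0.
  by have := facet_mx_unit P0 hsimp j; rewrite unitmxE det_map_mx unitfE intr_eq0.
have FE := facet_of_simplex j.
exact: (normalized_vol_simplex_pred hd Vw V0 FE).
Qed.

Theorem boundary_volE : boundary_vol P =
  ((\sum_j `|\det (vmx j) |) / (d.-1)`!%:R)%:E.
Proof.
rewrite /boundary_vol (_ : [set F | facet P F] = range (@facet_of R d P D)).
  rewrite fsbig_image; last by move=> j j' _ _; exact: facet_of_inj.
  under eq_fsbigr do rewrite normalized_vol_facet.
  rewrite mulr_suml -sumEFin (fsbig_seq _ _ (index_enum_uniq 'I_q)).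
  rewrite (_ : [set` index_enum 'I_q] = setT)//.
  by apply/seteqP; split => j //= _; rewrite mem_index_enum.
apply/seteqP; split=> F.
  by move=> /(facetP D P0 hsimp hdim hd)[j ->]; exists j.
by move=> [j _ <-]; apply/(facetP D P0 hsimp hdim hd); exists j.
Qed.

Lemma card_facets : f_vector P d.-1 = q.
Proof.
rewrite /f_vector (@card_fset_set_image _ _ [set: 'I_q]%SET (@facet_of R d P D)).
- by rewrite cardsT card_ord.
- by move=> j j' _ _; exact: facet_of_inj.
apply/seteqP; split=> F /=.
  by move=> /(facetP D P0 hsimp hdim hd)[j ->]; exists j => //=; rewrite inE.
by move=> [j _ <-]; apply/(facetP D P0 hsimp hdim hd); exists j.
Qed.

End PolytopeVolume.

(** * Counting compositions *)

Lemma sum_bin_col t k : (\sum_(b < t) 'C(b, k) = 'C(t, k.+1))%N.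
Proof.
elim: t => [|t IH]; first by rewrite big_ord0.
by rewrite big_ord_recr /= IH binS.
Qed.

(** Truncations in degree M of 1 / (1 - X) and of X / (1 - X). *)
Definition geom (M : nat) : {poly int} := \poly_(t < M.+1) 1.

Definition geom_pos (M : nat) : {poly int} := \sum_(a < M.+1 | a != 0 :> nat) 'X^a.

Lemma coef_geom_pos M t : (t <= M)%N -> (geom_pos M)`_t = (t != 0%N)%:R.
Proof.
move=> tM; rewrite coef_sum.
have tM1 : (t < M.+1)%N by [].
rewrite big_mkcond (bigD1 (Ordinal tM1))//= coefXn eqxx big1 ?addr0.
  by case: eqP.
by move=> a; rewrite -val_eqE /= coefXn eq_sym => /negPf ->; case: ifP.
Qed.

(** Up to degree M this is the expansion of X^k / (1 - X)^(k+1); multiplying by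
X / (1 - X) sums the previous coefficients (hockey-stick identity). *)
Lemma coef_geom_pow M k t : (t <= M)%N ->
  (geom M * geom_pos M ^+ k)`_t = ('C(t, k))%:R.
Proof.
elim: k t => [|k IH] t tM; first by rewrite expr0 mulr1 coef_poly ltnS tM bin0.
rewrite exprSr mulrA coefM big_ord_recr /= subnn coef_geom_pos// mulr0 addr0.
rewrite -sum_bin_col natr_sum; apply: eq_bigr => i _.
have it := ltn_ord i.
rewrite IH ?(leq_trans (ltnW it))// coef_geom_pos; last exact: leq_trans (leq_subr _ _) tM.
by rewrite -lt0n subn_gt0 it mulr1.
Qed.

Section Compositions.
Variables (n m : nat).

Definition supp (c : {ffun 'I_n -> 'I_m.+1}) : {set 'I_n} := [set k | c k != 0 :> nat]%SET.

(** The coordinates outside S are 0 and those in S range over 1, ..., m: expand the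
product. *)
Lemma geom_pos_pow (S : {set 'I_n}) : geom_pos m ^+ #|S| =
  \sum_(c : {ffun 'I_n -> 'I_m.+1} | supp c == S) 'X^(\sum_k c k).
Proof.
rewrite -prodr_const big_mkcond /=.
transitivity (\prod_k \sum_(a < m.+1)
    (if (a != 0 :> nat) == (k \in S) then 'X^a else 0 : {poly int})).
  apply: eq_bigr => k _; rewrite -big_mkcond /=; case: (k \in S).
    by apply: eq_bigl => a; rewrite eqb_id.
  rewrite (bigD1 ord0)//= big1 ?addr0// => a /andP[].
  by rewrite eqbF_neg negbK -val_eqE /= => /eqP ->.
rewrite bigA_distr_bigA [RHS]big_mkcond; apply: eq_bigr => c _ /=.
have [cS|cS] := eqVneq (supp c) S.
  rewrite -prodrXr; apply: eq_bigr => k _; rewrite -cS inE.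
  by rewrite eqxx.
have [k kc] : exists k, (c k != 0 :> nat) != (k \in S).
  apply/existsP; apply: contraNT cS; rewrite negb_exists => /forallP cS.
  by apply/eqP/setP => k; rewrite inE; have := cS k; rewrite negbK => /eqP.
by rewrite (bigD1 k)//= (negPf kc) mul0r.
Qed.

(** The factor [geom] turns a sum equal to m into a sum at most m. *)
Lemma card_supp_le (S : {set 'I_n}) :
  #|[set c : {ffun 'I_n -> 'I_m.+1} | (supp c == S) && (\sum_k c k <= m)%N]%SET| = 'C(m, #|S|).
Proof.
apply/eqP; rewrite -(eqr_nat int) -(coef_geom_pow _ (leqnn m)) geom_pos_pow.
rewrite mulr_sumr coef_sum -sum1_card natr_sum; apply/eqP.
rewrite [LHS](eq_bigl (fun c => (supp c == S) && (\sum_k c k <= m)%N)); last first.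
  by move=> c; rewrite inE.
rewrite big_mkcondr /=; apply: eq_bigr => c _.
rewrite coefMXn ltnNge; case: leqP => //= cm.
by rewrite coef_poly ltnS leq_subr.
Qed.

End Compositions.

(** The series of the binomials in column k is X^k / (1 - X)^(k+1); multiply by
(1 - X)^(d+1), working modulo X^(m+1). *)
Lemma bin_convolution d k m : (k <= d)%N ->
  \sum_(j < m.+1) ((1 - 'X) ^+ d.+1 : {poly int})`_j * ('C(m - j, k))%:R =
  ('X^k * (1 - 'X) ^+ (d - k) : {poly int})`_m.
Proof.
move=> kd; pose g k := \poly_(t < m.+1) (('C(t, k))%:R : int).
have H : exists r, (1 - 'X) ^+ k.+1 * g k = 'X^k + 'X^(m.+1) * r.
  elim: k {kd} => [|k [r IH]].
    exists (-1); apply/polyP => t; rewrite expr1 mulrBl mul1r expr0 mulrN1.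
    rewrite !coefB coefXM coefC coefXn !coef_poly !bin0.
    case: t => [|t] /=; first by rewrite subr0.
    by rewrite !ltnS eqSS; case: (ltngtP t m).
  exists (r * 'X - (1 - 'X) ^+ k.+1 * (('C(m.+1, k.+1))%:R)%:P).
  have -> : (1 - 'X) ^+ k.+2 * g k.+1 =
      (1 - 'X) ^+ k.+1 * ('X * g k - 'X^(m.+1) * (('C(m.+1, k.+1))%:R)%:P).
    rewrite exprSr -mulrA; congr (_ * _); apply/polyP => t.
    rewrite mulrBl mul1r !coefB coefXM coefXnM coefXM coefC !coef_poly.
    case: t => [|t] /=; first by rewrite bin0n /= !subr0.
    rewrite !ltnS subSS subn_eq0 binS natrD.
    case: (ltngtP t m) => [tm|tm|->]; rewrite ?binS ?natrD /=; ring.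
  rewrite mulrBr mulrCA IH (exprS 'X k).
  set C := polyC _; move: C ((1 - 'X) ^+ k.+1) => p4 p1.
  move: ('X^k) ('X^(m.+1)) => p2 p3.
  ring.
have [r Hr] := H.
transitivity (((1 - 'X) ^+ d.+1 * g k : {poly int})`_m).
  rewrite coefM; apply: eq_bigr => j _; rewrite coef_poly ltnS leq_subr //.
rewrite -(subnK kd) -addnS exprD -mulrA Hr mulrDr coefD addnK mulrC.
rewrite [X in _ + X = _](_ : _ = 0) ?addr0//.
by rewrite mulrCA coefXnM ltnSn.
Qed.

(** * The Ehrhart function *)

Lemma finite_fset_set_gt0 (T : choiceType) (A : set T) :
  (0 < #|` fset_set A|)%N -> finite_set A.
Proof.
rewrite /fset_set; case: pselect => //= _.
Qed.

(** S is finite, since [fset_set] is empty on infinite sets, so the image of f is a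
subset of a finite set of the same size. *)
Lemma card_image_eq (T : choiceType) (I : finType) (A : {set I}) (f : I -> T)
    (S : set T) : {in A &, injective f} -> (forall c, c \in A -> S (f c)) ->
  (0 < #|A|)%N -> #|` fset_set S| = #|A| -> S = f @` [set` A].
Proof.
move=> fi fS A0 cS; have finS : finite_set S by apply: finite_fset_set_gt0; rewrite cS.
have finA : finite_set (f @` [set` A]) by apply: finite_image; exact: finite_finpred.
apply: (@fset_set_inj _ _ _) => //; apply/eqP; rewrite eq_sym.
rewrite eqEfcard; apply/andP; split.
  apply/fsubsetP => y; rewrite !in_fset_set// => /set_mem[c cA <-].
  by apply/mem_set/fS.
by rewrite cS (card_fset_set_image fi).
Qed.

Section Ehrhart.
Variables (R : realType) (d : nat) (P : set 'rV[R]_d) (D : dual_pair P).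
Hypotheses (P0 : P° 0) (hsimp : simplicial P) (hdim : has_dim P d).

Local Notation n := (nv D).
Local Notation q := (nf D).
Local Notation U := (map_mx intr (vert D) : 'M[R]_(n, d)).
Implicit Types (j : 'I_q) (m : nat).

Definition lattice_points m := [set m%:R *: x | x in P] `&` @int_lattice R d.

Definition boundary_simplex (S : {set 'I_n}) := [exists j : 'I_q, S \subset tight j].

(** The bound m on each coefficient follows from the bound on their sum; it is in
the type in order to have a finite type. *)
Definition combos m : {set {ffun 'I_n -> 'I_m.+1}} :=
  [set c | boundary_simplex (supp c) && (\sum_k c k <= m)%N]%SET.

Definition coefs m (c : {ffun 'I_n -> 'I_m.+1}) : 'rV[R]_n := \row_k (c k)%:R.

Definition combo m (c : {ffun 'I_n -> 'I_m.+1}) : 'rV[R]_d := coefs c *m U.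

Lemma coefs_nonneg m (c : {ffun 'I_n -> 'I_m.+1}) : nonneg (coefs c).
Proof. by move=> k; rewrite mxE. Qed.

Lemma coefs_supported m (c : {ffun 'I_n -> 'I_m.+1}) j : supp c \subset tight j ->
  supported (tight j) (coefs c).
Proof.
move=> /fintype.subsetP cT k kT; rewrite mxE.
by have := contra (cT k) kT; rewrite inE negbK => /eqP ->.
Qed.

Lemma coefs_inj m : injective (@coefs m).
Proof.
move=> c c' E; apply/ffunP => k; have /rowP/(_ k) := E.
by rewrite !mxE => /eqP; rewrite eqr_nat => /eqP /val_inj.
Qed.

Lemma combo_inj m : {in combos m &, injective (@combo m)}.
Proof.
move=> c c'; rewrite !inE => /andP[/existsP[j cT] _] /andP[/existsP[j' cT'] _] E.
apply: coefs_inj; apply: (cone_unique P0 hsimp _ _ _ _ E).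
- exact: coefs_nonneg.
- exact: coefs_nonneg.
- exact: (coefs_supported cT).
- exact: (coefs_supported cT').
Qed.

Lemma combo_lattice m c : c \in combos m -> lattice_points m (combo c).
Proof.
rewrite inE => /andP[/existsP[j cT] cm]; split.
  apply/(cone_in_dilate P0 m (@coefs_nonneg _ c) (coefs_supported cT)).
  by under eq_bigr do rewrite mxE; rewrite -natr_sum ler_nat.
exists ((\row_k (c k)%:Z) *m vert D) => //.
rewrite map_mxM; congr (_ *m _); apply/rowP => k; rewrite !mxE.
by rewrite pmulrn.
Qed.

Lemma combos_gt0 m : (0 < #|combos m|)%N.
Proof.
rewrite card_gt0; apply/set0Pn; exists [ffun=> ord0]; rewrite inE.
apply/andP; split; last by rewrite big1// => k _; rewrite ffunE.
apply/existsP; exists (Ordinal (nf_gt0 D)); apply/fintype.subsetP => k.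
by rewrite inE ffunE.
Qed.

Lemma ehrhart_combos m :
  ehrhart P m = #|combos m| <-> lattice_points m = @combo m @` [set` combos m].
Proof.
split=> [h|h].
  apply: card_image_eq h; [exact: combo_inj|exact: combo_lattice|exact: combos_gt0].
by rewrite /ehrhart -/(lattice_points m) (card_fset_set_image (@combo_inj m)).
Qed.

Lemma card_boundary_simplex S : boundary_simplex S -> (#|S| <= d)%N.
Proof.
by move=> /existsP[j /subset_leq_card]; rewrite (card_tight P0 hsimp).
Qed.

(** Sort the combinations by their support, a simplex of the boundary complex. *)
Lemma card_combos m : #|combos m| = (\sum_(k < d.+1) #|simplices D k| * 'C(m, k))%N.
Proof.
rewrite -sum1_card (partition_big (fun c => supp c) boundary_simplex) /=; last first.
  by move=> c; rewrite inE => /andP[].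
transitivity (\sum_(S | boundary_simplex S) 'C(m, #|S|))%N.
  apply: eq_bigr => S hS; rewrite -card_supp_le -sum1_card; apply: eq_bigl => c.
  by rewrite !inE andbC andbA; case: eqP => [->|_]; rewrite ?hS //= andbC.
rewrite (partition_big (fun S : {set 'I_n} => inord #|S| : 'I_d.+1) xpredT) //=.
apply: eq_bigr => k _; rewrite -sum_nat_const; apply: eq_big => [S|S].
  rewrite inE andbC; apply: andb_id2r => hS.
  by rewrite -val_eqE /= inordK// ltnS card_boundary_simplex.
by move=> /andP[hS /eqP <-]; rewrite inordK// ltnS card_boundary_simplex.
Qed.

Lemma simplices0 : #|simplices D 0| = 1%N.
Proof.
rewrite (_ : simplices D 0 = [set finset.set0]%SET) ?cards1//.
apply/setP => S; rewrite !inE cards_eq0; case: eqP => //= ->.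
by apply/existsP; exists (Ordinal (nf_gt0 D)); exact: finset.sub0set.
Qed.

Lemma h_polyE : h_poly P =
  \sum_(k < d.+1) (#|simplices D k|%:R : int) *: ('X^k * (1 - 'X) ^+ (d - k)).
Proof.
rewrite big_ord_recl /= simplices0 scale1r expr0 mul1r subn0 /h_poly; congr (_ + _).
by apply: eq_bigr => i _; rewrite (f_vectorE D P0 hsimp hdim)//.
Qed.

Lemma size_h_poly : (size (h_poly P) <= d.+1)%N.
Proof.
rewrite h_polyE; apply: (leq_trans (size_sum _ _ _)); apply/bigmax_leqP => k _.
apply: leq_trans (size_scale_leq _ _) _.
apply: leq_trans (size_mul_leq _ _) _; rewrite size_polyXn /=.
rewrite -[1 - 'X]opprB; have -> : 'X - 1 = 'X - 1%:P :> {poly int} by [].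
rewrite exprNn.
have kd : (k <= d)%N by rewrite -ltnS.
rewrite -signr_odd; apply: (@leq_trans (k + (d - k).+1)).
  rewrite leq_add2l; case: (odd _);
    by rewrite /= ?expr1 ?expr0 ?mulN1r ?mul1r ?size_polyN size_exp_XsubC.
by rewrite addnS subnKC.
Qed.

(** Each simplex with k vertices contributes X^k (1 - X)^(d - k), by
[bin_convolution], and this is its term in the h-polynomial. *)
Lemma combos_delta m : \sum_(j < m.+1) ((1 - 'X) ^+ d.+1 : {poly int})`_j *
  (#|combos (m - j)|%:R) = (h_poly P)`_m.
Proof.
rewrite h_polyE coef_sum; under eq_bigr do rewrite card_combos natr_sum mulr_sumr.
rewrite exchange_big /=; apply: eq_bigr => k _.
rewrite coefZ -bin_convolution; last by rewrite -ltnS.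
by rewrite mulr_sumr; apply: eq_bigr => j _; rewrite natrM mulrCA.
Qed.

Lemma delta_poly_unique p : is_delta_poly P p -> delta_poly P = p.
Proof.
move=> hp; apply: xget_unique => // p' hp'.
by apply/polyP => k; rewrite -hp.2 -hp'.2.
Qed.

(** If h = delta then, as h_0 is not 0, [delta_poly] is not its default value, so
that it satisfies its defining identity.  This identity determines the Ehrhart
function, because (1 - t)^(d+1) has constant coefficient 1, and the counting
function of the integer combinations satisfies the same one. *)
Lemma h_delta_combos :
  (forall k, (k <= d)%N -> h_vector P k = delta_vector P k) <->
  (forall m, ehrhart P m = #|combos m|).
Proof.
split=> [h|h]; last first.
  suff E : delta_poly P = h_poly P by move=> k _; rewrite /delta_vector E.
    apply: delta_poly_unique; split; first exact: size_h_poly.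
    by move=> m; rewrite -combos_delta; apply: eq_bigr => j _; rewrite h.
have hp : is_delta_poly P (delta_poly P).
  apply: contrapT => nd.
  have := h 0%N (leq0n d); rewrite /h_vector /delta_vector -combos_delta.
  rewrite /delta_poly xgetPN; last first.
    move=> p hp; apply: nd; rewrite /delta_poly.
    by case: xgetP => [//|/(_ p)].
  rewrite coef0 big_ord1 subnn => /eqP; rewrite mulf_eq0 pnatr_eq0.
  rewrite eqn0Ngt combos_gt0 orbF -horner_coef0 !hornerE expr1n oner_eq0 //.
have E : h_poly P = delta_poly P.
  apply/polyP => k; have [kd|dk] := leqP k d; first exact: h.
  by rewrite !nth_default// (leq_trans _ dk)// ?size_h_poly ?hp.1.
have a0 : ((1 - 'X) ^+ d.+1 : {poly int})`_0 = 1.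
  by rewrite -horner_coef0 !hornerE expr1n.
elim/ltn_ind => m IH; have := hp.2 m; rewrite -E -combos_delta.
rewrite !big_ord_recl /= a0 !mul1r subn0 => H.
apply/eqP; rewrite -(eqr_nat int); apply/eqP; move: H.
rewrite [X in _ + X = _](eq_bigr (fun i : 'I_m =>
    ((1 - 'X) ^+ d.+1 : {poly int})`_(bump 0 i) * #|combos (m - bump 0 i)|%:R)).
  by move/addIr.
move=> i _; rewrite IH// /bump /= add1n; have := ltn_ord i; lia.
Qed.

End Ehrhart.

(** * Smoothness *)

Section Smooth.
Variables (R : realType) (d : nat) (P : set 'rV[R]_d) (D : dual_pair P).
Hypotheses (P0 : P° 0) (hsimp : simplicial P) (hdim : has_dim P d) (hd : (0 < d)%N).
Hypothesis hP : lattice_polytope P.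

Local Notation n := (nv D).
Local Notation q := (nf D).
Local Notation U := (map_mx intr (vert D) : 'M[R]_(n, d)).
Local Notation vmx := (@facet_mx R d P D P0 hsimp).
Local Notation imx := (@facet_imx R d P D P0 hsimp).
Implicit Types (j : 'I_q) (m : nat).

(** Expanding the unit vectors gives an integral inverse. *)
Lemma int_span_unit j : (forall z : 'rV[int]_d, exists a : 'rV[int]_d,
    map_mx intr z = map_mx intr a *m vmx j) -> imx j \in unitmx.
Proof.
move=> /choice[a aP].
have : (\matrix_i a (row i 1%:M)) *m imx j = 1%:M.
  apply/row_matrixP => i; rewrite row_mul rowK; apply: (@map_intr_inj R).
  by rewrite map_mxM -aP.
by move/mulmx1_unit => [].
Qed.

Lemma unit_Z_basis j : imx j \in unitmx -> Z_basis (@int_lattice R d) (vmx j).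
Proof.
move=> uj; split=> [i|_ [z _ <-]]; first exact: int_lattice_map.
exists (z *m invmx (imx j)); split=> [|a].
  by rewrite -map_mxM mulmxKV.
by rewrite -map_mxM => /map_intr_inj ->; rewrite mulmxK.
Qed.

(** A Z-basis with the vertices of the facet as its set of rows spans Z^d over the
integers, hence so do the rows of [facet_mx]. *)
Lemma smooth_unitP : smooth_Fano P <-> forall j, imx j \in unitmx.
Proof.
split=> [[_ _ _ sF] j|uj]; last first.
  split=> // F /(facetP D P0 hsimp hdim hd)[j ->]; exists d, (vmx j); split.
    exact: vertex_facet_of.
  exact: unit_Z_basis.
have [r [B [FB [_ Bz]]]] := sF _ (facet_of_facet P0 hsimp hd j).
have /choice[s sP] : forall i : 'I_r, exists l : 'I_d, row i B = row l (vmx j).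
  move=> i; have : vertex (facet_of j) (row i B) by rewrite FB; exists i.
  by rewrite (vertex_facet_of P0 hsimp) => -[l _ <-]; exists l.
apply: int_span_unit => z; have [|c [-> _]] := Bz (map_mx intr z); first by exists z.
exists (c *m \matrix_i delta_mx 0 (s i)).
rewrite map_mxM -mulmxA; congr (_ *m _); apply/row_matrixP => i.
by rewrite row_mul -map_row rowK map_delta_mx -rowE sP.
Qed.

(** If V_j is unimodular for all j, the coefficients of a lattice point on the
vertices of its facet are integers.  Conversely, adding to a lattice point z a
large multiple N of the sum of the vertices of facet j moves it into the cone of
this facet without changing whether its coefficients are integers; there
uniqueness identifies them with those of an integer combination. *)
Lemma unit_combosP : (forall j, imx j \in unitmx) <->
  forall m, lattice_points P m = @combo _ _ _ D m @` [set` combos D m].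
Proof.
split=> [uj m|h j].
  apply/seteqP; split=> [x [mx [z _ zx]]|_ [c cm <-]]; last exact: combo_lattice.
  have [j [c [cT c0 xE]]] := cone_cover D P0 hsimp x.
  have cm : \sum_k c 0 k <= m%:R by apply/(cone_in_dilate P0 m c0 cT); rewrite -xE.
  pose y := \row_i c 0 (corner_vert P0 hsimp j i).
  have yE : y = map_mx intr (z *m invmx (imx j)).
    apply: (can_inj (mulmxK (facet_mx_unit P0 hsimp j))).
    by rewrite -spread_mul -spreadK// -xE -map_mxM mulmxKV.
  have cN k : exists a : nat, c 0 k = a%:R.
    have [kT|kT] := boolP (k \in tight j); last by exists 0%N; rewrite cT.
    have [i ki] := corner_vertP P0 hsimp kT.
    have : c 0 k = ((z *m invmx (imx j)) 0 i)%:~R.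
      by have /rowP/(_ i) := yE; rewrite mxE -ki => ->; rewrite mxE.
    move=> E; have := c0 k; rewrite E ler0z.
    by case: ((z *m invmx (imx j)) 0 i) => // a _; exists a; rewrite pmulrn.
  have /choice[a aP] := cN.
  have sa : (\sum_k a k <= m)%N.
    by rewrite -(ler_nat R) natr_sum (eq_bigr (fun k => c 0 k)).
  have am k : (a k < m.+1)%N.
    by rewrite ltnS; apply: leq_trans sa; rewrite (bigD1 k)//= leq_addr.
  pose f : {ffun 'I_n -> 'I_m.+1} := [ffun k => Ordinal (am k)].
  have fk k : f k = a k :> nat by rewrite ffunE.
  exists f.
    rewrite /= inE; apply/andP; split; last by rewrite (eq_bigr (fun k => a k)).
    apply/existsP; exists j; apply/fintype.subsetP => k; rewrite inE fk.
    by apply: contraNT => /cT; rewrite aP => /eqP; rewrite pnatr_eq0.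
  rewrite xE /combo; congr (_ *m _); apply/rowP => k.
  by rewrite mxE fk aP.
apply: int_span_unit => z.
have [y zE] : exists y, map_mx intr z = y *m vmx j.
  by exists (map_mx intr z *m invmx (vmx j)); rewrite mulmxKV ?facet_mx_unit.
pose N := Num.Def.archi_bound (\sum_i `|y 0 i|).
have yN i : 0 <= y 0 i + N%:R.
  rewrite -lerBlDr sub0r; apply: le_trans (lerNnormlW (lexx _)).
  rewrite lerN2; apply: ltW; apply: le_lt_trans (archi_boundP _); last exact: sumr_ge0.
  by rewrite (bigD1 i)//= lerDl sumr_ge0.
pose y' : 'rV[R]_d := y + const_mx N%:R.
have y'0 i : 0 <= y' 0 i by rewrite !mxE.
pose c := spread P0 hsimp j y'.
have c0 : nonneg c by exact: spread_nonneg.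
have cT : supported (tight j) c by exact: spread_supported.
pose m := Num.Def.archi_bound (\sum_k c 0 k).
have xm : lattice_points P m (c *m U).
  split.
    by apply/(cone_in_dilate P0 m c0 cT)/ltW/archi_boundP/sumr_ge0.
  exists (z + const_mx N%:Z *m imx j) => //.
  rewrite spread_mul mulmxDl -zE map_mxD map_mxM; congr (_ + _ *m _).
  by apply/rowP => i; rewrite !mxE pmulrn.
move: xm; rewrite h => -[f]; rewrite /= inE => /andP[/existsP[j' fT] _] fE.
have cf : c = coefs f.
  apply: (cone_unique P0 hsimp c0 (@coefs_nonneg _ _ _ _ _ f) cT (coefs_supported fT)).
  by rewrite -fE.
exists (\row_i ((f (corner_vert P0 hsimp j i))%:Z - N%:Z)).
rewrite zE; congr (_ *m _); apply/rowP => i; rewrite !mxE.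
have : c 0 (corner_vert P0 hsimp j i) = y 0 i + N%:R by rewrite spread_cvert !mxE.
by rewrite cf mxE rmorphB /= -!pmulrn => ->; rewrite addrK.
Qed.

Lemma norm_det_ge1 j : 1 <= `|\det (vmx j)|.
Proof.
rewrite det_map_mx -intr_norm ler1z -gtz0_ge1 normr_gt0.
by have := facet_mx_unit P0 hsimp j; rewrite unitmxE det_map_mx unitfE intr_eq0.
Qed.

Lemma norm_det_eq1 j : (imx j \in unitmx) = (`|\det (vmx j)| == 1).
Proof.
rewrite det_map_mx -intr_norm (_ : 1 = 1%:~R :> R)// eqr_int.
by rewrite unitmxE qualifE /= eqr_norml ler01 andbT.
Qed.

Lemma unit_sumP : (forall j, imx j \in unitmx) <->
  q%:R = \sum_j `|\det (vmx j)|.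
Proof.
split=> [uj|].
  rewrite (eq_bigr (fun=> 1)); first by rewrite sumr_const card_ord.
  by move=> j _; apply/eqP; rewrite -norm_det_eq1.
move=> E j; rewrite norm_det_eq1; apply/eqP.
have : \sum_j (`|\det (vmx j)| - 1) = 0.
  by rewrite sumrB -E sumr_const card_ord subrr.
move/eqP; rewrite psumr_eq0; last by move=> i _; rewrite subr_ge0 norm_det_ge1.
move=> /allP/(_ j); rewrite mem_index_enum => /(_ isT).
by rewrite subr_eq0 => /eqP.
Qed.

Lemma facets_volP k (v : \bar R) : v = ((\sum_j `|\det (vmx j)|) / k`!%:R)%:E ->
  (f_vector P d.-1)%:R%:E = (k`!%:R%:E * v)%E <-> forall j, imx j \in unitmx.
Proof.
move=> ->; rewrite unit_sumP (card_facets D P0 hsimp hdim hd) -EFinM mulrC divfK.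
  by split=> [[]|->].
by rewrite pnatr_eq0 -lt0n fact_gt0.
Qed.

End Smooth.

Theorem theorem1p5 (R : realType) (d : nat) (hd : (0 < d)%N)
    (P : set 'rV[R]_d) (hrefl : reflexive_polytope P) (hsimp : simplicial P) :
  [<-> smooth_Fano P;
       forall k : nat, (k <= d)%N -> h_vector P k = delta_vector P k;
       (f_vector P d.-1)%:R%:E = ((d`!)%:R%:E * vol P)%E;
       (f_vector P d.-1)%:R%:E = (((d.-1)`!)%:R%:E * boundary_vol P)%E].
Proof.
have [hP hdim P0 hdual] := hrefl.
have [D] := dual_pair_exists hP hdual.
have h1 := smooth_unitP D P0 hsimp hdim hd hP.
have h2 : (forall k : nat, (k <= d)%N -> h_vector P k = delta_vector P k) <->
    (forall j, facet_imx (D := D) P0 hsimp j \in unitmx).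
  rewrite (unit_combosP D P0 hsimp) (h_delta_combos D P0 hsimp hdim).
  by split=> h m; apply/(ehrhart_combos D P0 hsimp).
have h3 := facets_volP hdim hd (vol_polytope D P0 hsimp).
have h4 := facets_volP hdim hd (boundary_volE D P0 hsimp hdim hd).
tfae.
- by move=> /h1/h2.
- by move=> /h2/h3.
- by move=> /h3/h4.
- by move=> /h4/h1.
Qed.
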